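(* Let $\Sigma\setminus\{P_0\}$ be of class $C^2$, assume $\mathrm{Ker}(-\pi\mathcal I+\mathcal W+\mathcal S)=\{0\}$ in $\mathcal X$, and let $m_0$ be such that for $m\ge m_0$ the operators $-\pi\mathcal I+\tilde{\mathcal W}_m+\mathcal S_m$ are invertible on $\mathcal X$ with uniformly bounded inverses. Let $g$ be a sufficiently smooth boundary function on $\Sigma$, $\bar g=(g\circ\sigma_1,g\circ\sigma_2,g\circ\sigma_3)^T$, let $\bar\psi$ solve $(-\pi\mathcal I+\mathcal W+\mathcal S)\bar\psi=\bar g$ (with the regularity (R) of the context) and, for $m\ge m_0$, let $\bar\psi_m$ solve $(-\pi\mathcal I+\tilde{\mathcal W}_m+\mathcal S_m)\bar\psi_m=\bar g$. Let $u$ be the double layer potential solving the Dirichlet problem $\Delta u=0$ in $D$, $u=g$ on $\Sigma$, i.e. $$u(x,y)=\sum_{i=1}^3\int_0^1H_i(x,y,t)\bar\psi_i(t)\,dt,\quad (x,y)\in D,$$ and let $$u_m(x,y)=\sum_{i=1}^3\sum_{h=0}^{m+1}\lambda_hH_i(x,y,x_h)\bar\psi_{m,i}(x_h).$$ Then, for any $(x,y)\in D$ and $m\ge m_0$, $$|u(x,y)-u_m(x,y)|\le\frac Cm\left(\frac1{d^2}+\frac1d\right)+\frac{C'}d\|\bar\psi-\bar\psi_m\|_\infty,$$ where $d=\min_{i=1,2,3}d_i$, $d_i=\min_{0\le t\le1}|(x,y)-(\xi_i(t),\eta_i(t))|$, and $C,C'$ are positive constants independent of $(x,y)$ and $m$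.
   Context: Geometry. $D\subset\mathbb R^2$ is a simply connected bounded region whose boundary $\Sigma$ is a simple closed piecewise smooth curve, twice continuously differentiable except for a single corner $P_0$ with interior angle $\phi=(1-\chi)\pi$, $-1<\chi<1$, $\chi\ne0$. $\Sigma$ is split into three arcs: proceeding counterclockwise, $\Sigma_1$ and $\Sigma_2$ are two sufficiently small smooth arcs meeting at $P_0$, so short that they essentially coincide with the tangent segments to $\Sigma$ at $P_0$ ($\max_{(x,y)\in\Sigma_i}|y-y_{t_i}|\le\delta$, $i=1,2$, with $y_{t_i}$ the ordinate of the point of abscissa $x$ on the segment tangent to $\Sigma_i$ at $P_0$ and $\delta$ a very small positive number); $\Sigma_3$ is the remaining arc connecting $\Sigma_1$ and $\Sigma_2$. Each $\Sigma_i$ has a parametrization $\sigma_i=(\xi_i,\eta_i)\in C^2([0,1])$ with $|\sigma_i'|\neq0$ on $[0,1]$; $\sigma_2,\sigma_3$ are oriented counterclockwise and $\sigma_1$ clockwise along $\Sigma$, with $\sigma_1(0)=\sigma_2(0)=P_0$, $\sigma_2(1)=\sigma_3(0)$, $\sigma_1(1)=\sigma_3(1)$. Kernels. Put $\omega_1=-1$, $\omega_2=\omega_3=1$. For $t,s\in[0,1]$, $$K^{i,j}(t,s)=\omega_j\frac{\eta_j'(t)[\xi_i(s)-\xi_j(t)]-\xi_j'(t)[\eta_i(s)-\eta_j(t)]}{[\xi_i(s)-\xi_j(t)]^2+[\eta_i(s)-\eta_j(t)]^2}\quad(i\ne j\text{ or }t\neq s),$$ $$K^{j,j}(t,t)=\frac{\omega_j}2\,\frac{\eta_j'(t)\xi_j''(t)-\xi_j'(t)\eta_j''(t)}{[\xi_j'(t)]^2+[\eta_j'(t)]^2}$$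 (that is, $K^{i,j}(t,s)=|\sigma_j'(t)|\,\partial_{\mathbf n_Q}\log|\sigma_i(s)-Q|$ at $Q=\sigma_j(t)$, $\mathbf n_Q$ the inner normal), and for $(x,y)\in D$ $$H_i(x,y,t)=\omega_i\frac{\eta_i'(t)[x-\xi_i(t)]-\xi_i'(t)[y-\eta_i(t)]}{[x-\xi_i(t)]^2+[y-\eta_i(t)]^2}.$$ Let $$L(t,s)=-\frac{s\sin(\chi\pi)}{s^2+2ts\cos(\chi\pi)+t^2},\qquad M^{i,j}=K^{i,j}-L\ \text{ for }(i,j)\in\{(1,2),(2,1)\}.$$ Standing fact/assumption: $K^{i,j}$ for $(i,j)\notin\{(1,2),(2,1)\}$ and $M^{1,2},M^{2,1}$ are continuous on $[0,1]\times[0,1]$ (extended by continuity where the formulas are undefined). Let $\mathcal K^{i,j},\mathcal L,\mathcal M^{i,j}$ be the corresponding integral operators, e.g. $(\mathcal L\rho)(s)=\int_0^1L(t,s)\rho(t)\,dt$, $\rho\in C([0,1])$. Spaces and operators. $C([0,1])^3$ has norm $\|(f_1,f_2,f_3)\|_\infty=\max_i\|f_i\|_\infty$. $\mathcal X=\{(f_1,f_2,f_3)^T\in C([0,1])^3: f_1(0)=f_2(0)\}$, $\mathcal I$ is the identity. With $\bar\Omega_1(s)=\bar\Omega_2(s)=\pi$ for $0<s\le1$ and $\bar\Omega_1(0)=\bar\Omega_2(0)=(1-\chi)\pi$, $$\mathcal W=\begin{pmatrix}(-\pi+\bar\Omega_1)I&\mathcal L&0\\ \mathcal L&(-\pi+\bar\Omega_2)I&0\\0&0&0\end{pmatrix},\qquad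 \mathcal S=\begin{pmatrix}\mathcal K^{1,1}&\mathcal M^{1,2}&\mathcal K^{1,3}\\ \mathcal M^{2,1}&\mathcal K^{2,2}&\mathcal K^{2,3}\\ \mathcal K^{3,1}&\mathcal K^{3,2}&\mathcal K^{3,3}\end{pmatrix}.$$ Discretization. The Lobatto rule on $[0,1]$ is $\int_0^1f\,dx\approx\sum_{h=0}^{m+1}\lambda_hf(x_h)$ with $x_0=0$, $x_{m+1}=1$, $x_1<\dots<x_m$ the zeros of the degree-$m$ orthogonal polynomial on $[0,1]$ with respect to the weight $v^{1,1}(x)=x(1-x)$, $\lambda_0=\lambda_{m+1}=\frac1{(m+1)(m+2)}$, $\lambda_k=\int_0^1\frac{l_k(x)v^{1,1}(x)}{v^{1,1}(x_k)}dx$ for $1\le k\le m$, $l_k$ the fundamental Lagrange polynomials on $x_1,\dots,x_m$. Define $(\mathcal L_m\rho)(s)=\sum_h\lambda_hL(x_h,s)\rho(x_h)$, and analogously $\mathcal M_m^{i,j}$, $\mathcal K_m^{i,j}$ with kernels $M^{i,j}$, $K^{i,j}$. $\mathcal W_m$ and $\mathcal S_m$ are obtained from $\mathcal W$ and $\mathcal S$ by replacing each $\mathcal L,\mathcal K^{i,j},\mathcal M^{i,j}$ by $\mathcal L_m,\mathcal K_m^{i,j},\mathcal M_m^{i,j}$. For a fixed constant $c>0$ and a fixed arbitrarily small $\epsilon>0$ (and $m$ with $c/m^{2-2\epsilon}\le1$), $$(\tilde{\mathcal W}_m\varrho)(s)=\begin{cases}(\mathcal W_m\varrho)(s),& \frac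 c{m^{2-2\epsilon}}\le s\le1,\\ \frac{m^{2-2\epsilon}}c\left[s(\mathcal W_m\varrho)\left(\frac c{m^{2-2\epsilon}}\right)+\left(\frac c{m^{2-2\epsilon}}-s\right)(\mathcal W\varrho)(0)\right],&0\le s<\frac c{m^{2-2\epsilon}}.\end{cases}$$ Double layer potential. The system $(-\pi\mathcal I+\mathcal W+\mathcal S)\bar\psi=\bar g$ is equivalent, via $\bar\psi_i=\psi\circ\sigma_i$, to the boundary integral equation $(-2\pi+\Omega(P))\psi(P)+\int_\Sigma\psi(Q)\partial_{\mathbf n_Q}\log|P-Q|\,d\Sigma_Q=g(P)$, $P\in\Sigma$ ($\Omega(P)$ the interior angle at $P$), and $u(A)=\int_\Sigma\psi(Q)\partial_{\mathbf n_Q}\log|A-Q|\,d\Sigma_Q$, $A\in D$. Regularity (R) (taken as known in the paper for smooth data): $\bar\psi_3$ is smooth and, for $i\in\{1,2\}$ and $0<t\le1$, $\bar\psi_i(t)-\bar\psi_i(0)=O(t^\beta)$ and $|\bar\psi_i^{(r)}(t)|\le C\,t^{\beta-r}$, $r=1,2,\dots$, with $\beta=\frac1{1+|\chi|}$. *)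

(* Defs.v *)
(* Conventions.
   - Points of the plane are pairs (x, y) : R * R.
   - The arcs Sigma_1, Sigma_2, Sigma_3 are indexed by 'I_3; sigma_i is given by
     its coordinate functions xi i, eta i : R -> R, of which only the values on
     [0, 1] are ever used.
   - Elements of C([0,1])^3 are functions f : 'I_3 -> R -> R; equality of two of
     them means equality on [0, 1].
   - In a kernel k i j t s, t is the integration variable (on the arc j) and s
     the evaluation variable (on the arc i). *)
From HB Require Import structures.
From mathcomp Require Import all_boot all_order all_algebra.
From mathcomp Require Import all_classical all_reals all_analysis.
Set Implicit Arguments.
Unset Strict Implicit.
Unset Printing Implicit Defensive.
Import Order.TTheory GRing.Theory Num.Theory.
Import numFieldNormedType.Exports.
Local Open Scope classical_set_scope.
Local Open Scope ring_scope.

Definition arc1 : 'I_3 := @Ordinal 3 0 isT.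
Definition arc2 : 'I_3 := @Ordinal 3 1 isT.
Definition arc3 : 'I_3 := @Ordinal 3 2 isT.

Section Calculus.
Context {R : realType}.

Definition I01 : set R := `[0, 1].
Definition square01 : set (R * R) := I01 `*` I01.

(* Derivative of f as a function on [0, 1]: one-sided at 0 and 1.  It is
   meaningful at t only under derivable01 f t. *)
Definition quotient01 (f : R -> R) (t : R) : set_system R :=
  (fun s => (f s - f t) / (s - t)) @ within I01 t^'.
Definition derivable01 (f : R -> R) (t : R) : Prop := cvg (quotient01 f t).
Definition deriv01 (f : R -> R) (t : R) : R := lim (quotient01 f t).
Definition derivn01 (r : nat) (f : R -> R) : R -> R := iter r deriv01 f.

Definition C2_on (A : set R) (f : R -> R) : Prop :=
  [/\ forall t, A t -> derivable01 f t,
      forall t, A t -> derivable01 (deriv01 f) t &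
      {within A, continuous (derivn01 2 f)}].

Definition smooth_on (A : set R) (f : R -> R) : Prop :=
  forall (r : nat) (t : R), A t -> derivable01 (derivn01 r f) t.

(* f on A, and its limit along A (extension by continuity) elsewhere. *)
Definition extend_by_continuity (A : set (R * R)) (f : R * R -> R) (p : R * R) : R :=
  if `[< A p >] then f p else lim (f @ within A (nbhs p)).

Definition integral01 (f : R -> R) : R := \int[lebesgue_measure]_(t in I01) f t.

Definition dist2 (A B : R * R) : R :=
  Num.sqrt ((A.1 - B.1) ^+ 2 + (A.2 - B.2) ^+ 2).

End Calculus.

Section Geometry.
Context {R : realType}.

(* Paths are parametrized by [0, 1]; H is a free homotopy, through closed paths
   of D, from the given closed path to a constant one. *)
Definition null_homotopic_in (D : set (R * R)) (gam : R -> R * R) : Prop :=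
  exists H : R * R -> R * R,
    [/\ {within square01, continuous H},
        forall p, square01 p -> D (H p),
        forall t, I01 t -> H (0, t) = gam t,
        forall s, I01 s -> H (s, 0) = H (s, 1) &
        exists A, forall t, I01 t -> H (1, t) = A].

Definition simply_connected_region (D : set (R * R)) : Prop :=
  [/\ D !=set0, open D, connected D &
      forall gam : R -> R * R,
        {within I01, continuous gam} -> gam 0 = gam 1 ->
        (forall t, I01 t -> D (gam t)) -> null_homotopic_in D gam].

Definition boundary (D : set (R * R)) : set (R * R) := closure D `\` interior D.

Record simple_closed_curve (C : set (R * R)) (P0 : R * R) (x y : R -> R) : Prop := {
  scc_continuous : {within I01, continuous (fun t => (x t, y t))};
  scc_start : (x 0, y 0) = P0;
  scc_end : (x 1, y 1) = P0;
  scc_simple : forall s t : R, 0 <= s -> s < t -> t < 1 -> (x s, y s) <> (x t, y t);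
  scc_image : C = [set (x t, y t) | t in I01];
  scc_C2x : C2_on `]0, 1[ x;
  scc_C2y : C2_on `]0, 1[ y;
  scc_regular : forall t : R, 0 < t < 1 -> (deriv01 x t, deriv01 y t) <> (0, 0) }.

(* Counterclockwise: the direction (-y', x') points from the curve into D. *)
Definition counterclockwise (D : set (R * R)) (x y : R -> R) : Prop :=
  forall t : R, 0 < t < 1 ->
    \forall e \near (0 : R)^'+, D (x t - e * deriv01 y t, y t + e * deriv01 x t).

(* (u, v) parametrizes the piece of the curve (x, y) running from parameter p to
   parameter q; th is increasing if p < q, decreasing if q < p. *)
Definition parametrizes_piece (x y : R -> R) (p q : R) (u v : R -> R) : Prop :=
  exists th : R -> R,
    [/\ {within I01, continuous th},
        (forall s t, I01 s -> I01 t -> th s = th t -> s = t),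
        th 0 = p, th 1 = q &
        forall t, I01 t -> u t = x (th t) /\ v t = y (th t)].

Definition speed (x y : R -> R) (t : R) : R :=
  Num.sqrt (deriv01 x t ^+ 2 + deriv01 y t ^+ 2).

Definition Sigma (xi eta : 'I_3 -> R -> R) : set (R * R) :=
  [set P | exists (i : 'I_3) (t : R), I01 t /\ P = (xi i t, eta i t)].

Record corner_domain (D : set (R * R)) (P0 : R * R) (chi delta : R)
    (xi eta : 'I_3 -> R -> R) : Prop := {
  cd_region : simply_connected_region D;
  cd_bounded : bounded_set D;
  cd_boundary : boundary D = Sigma xi eta;
  cd_curve : exists (x y : R -> R) (a b : R),
    [/\ simple_closed_curve (Sigma xi eta) P0 x y,
        counterclockwise D x y,
        0 < a /\ a < b /\ b < 1 &
        [/\ parametrizes_piece x y 1 b (xi arc1) (eta arc1),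
            parametrizes_piece x y 0 a (xi arc2) (eta arc2) &
            parametrizes_piece x y a b (xi arc3) (eta arc3)]];
  cd_C2 : forall i, C2_on I01 (xi i) /\ C2_on I01 (eta i);
  cd_regular : forall i t, I01 t -> speed (xi i) (eta i) t != 0;
  cd_chi : -1 < chi < 1 /\ chi != 0;
  (* The interior angle at P0 is phi = (1 - chi) pi: since D lies to the left of
     Sigma_2 when leaving P0, the direction of sigma_1'(0) is that of sigma_2'(0)
     rotated counterclockwise by phi, with phi in ]0, 2 pi[. *)
  cd_angle : let phi := (1 - chi) * pi in
    let v1 := speed (xi arc1) (eta arc1) 0 in
    let v2 := speed (xi arc2) (eta arc2) 0 in
    deriv01 (xi arc1) 0 / v1 =
      cos phi * (deriv01 (xi arc2) 0 / v2) - sin phi * (deriv01 (eta arc2) 0 / v2) /\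
    deriv01 (eta arc1) 0 / v1 =
      sin phi * (deriv01 (xi arc2) 0 / v2) + cos phi * (deriv01 (eta arc2) 0 / v2);
  cd_delta : 0 < delta;
  (* The point with the same abscissa on the segment tangent to Sigma_i at P0,
     namely P0 + tau sigma_i'(0), has an ordinate within delta. *)
  cd_near_tangent : forall i t, i != arc3 -> I01 t ->
    exists2 tau : R, 0 <= tau &
      xi i t = P0.1 + tau * deriv01 (xi i) 0 /\
      `|eta i t - (P0.2 + tau * deriv01 (eta i) 0)| <= delta }.

End Geometry.

Section Kernels.
Context {R : realType}.
Variables (chi : R) (xi eta : 'I_3 -> R -> R).

Definition omega (i : 'I_3) : R := if i == arc1 then -1 else 1.

Definition Kformula (i j : 'I_3) (t s : R) : R :=
  if (i == j) && (t == s) then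
    omega j / 2 *
    ((deriv01 (eta j) t * derivn01 2 (xi j) t - deriv01 (xi j) t * derivn01 2 (eta j) t) /
     (deriv01 (xi j) t ^+ 2 + deriv01 (eta j) t ^+ 2))
  else
    omega j *
    ((deriv01 (eta j) t * (xi i s - xi j t) - deriv01 (xi j) t * (eta i s - eta j t)) /
     ((xi i s - xi j t) ^+ 2 + (eta i s - eta j t) ^+ 2)).

Definition H (i : 'I_3) (A : R * R) (t : R) : R :=
  omega i *
  ((deriv01 (eta i) t * (A.1 - xi i t) - deriv01 (xi i) t * (A.2 - eta i t)) /
   ((A.1 - xi i t) ^+ 2 + (A.2 - eta i t) ^+ 2)).

(* L 0 0 has the junk value 0; it is met only inside integrals. *)
Definition L (t s : R) : R :=
  - (s * sin (chi * pi) / (s ^+ 2 + 2 * t * s * cos (chi * pi) + t ^+ 2)).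

Definition corner_pair (i j : 'I_3) : bool :=
  [&& i != j, i != arc3 & j != arc3].

(* The set of (t, s) where the formulas for K^{i,j} and M^{i,j} are defined. *)
Definition kernel_dom (i j : 'I_3) : set (R * R) :=
  square01 `&` [set p | i = j \/ (xi i p.2, eta i p.2) <> (xi j p.1, eta j p.1)].

(* Kernel of the (i, j) entry of S: M^{i,j} = K^{i,j} - L for (1,2) and (2,1),
   K^{i,j} otherwise, extended by continuity to the whole square. *)
Definition Skernel (i j : 'I_3) (t s : R) : R :=
  extend_by_continuity (kernel_dom i j)
    (fun p => Kformula i j p.1 p.2 - (if corner_pair i j then L p.1 p.2 else 0))
    (t, s).

Definition Skernels_continuous : Prop :=
  forall i j, {within square01, continuous (fun p => Skernel i j p.1 p.2)}.

Definition Omegabar (s : R) : R := if s == 0 then (1 - chi) * pi else pi.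

(* W and S with the functional Q in the place of the integral over [0, 1]:
   Q = integral01 gives W and S, Q = lobatto gives W_m and S_m. *)
Definition Wop (Q : (R -> R) -> R) (rho : 'I_3 -> R -> R) (i : 'I_3) (s : R) : R :=
  (if i == arc3 then 0 else (- pi + Omegabar s) * rho i s) +
  \sum_(j < 3 | corner_pair i j) Q (fun t => L t s * rho j t).

Definition Sop (Q : (R -> R) -> R) (rho : 'I_3 -> R -> R) (i : 'I_3) (s : R) : R :=
  \sum_(j < 3) Q (fun t => Skernel i j t s * rho j t).

End Kernels.

Section Spaces.
Context {R : realType}.

Definition supnorm (f : R -> R) : R := sup [set `|f t| | t in I01].
Definition norm3 (f : 'I_3 -> R -> R) : R := \big[Num.max/0]_(i < 3) supnorm (f i).

Definition inX (f : 'I_3 -> R -> R) : Prop :=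
  (forall i, {within I01, continuous (f i)}) /\ f arc1 0 = f arc2 0.

Definition eq01 (f g : 'I_3 -> R -> R) : Prop := forall i t, I01 t -> f i t = g i t.

Definition trivial_kernel (A : ('I_3 -> R -> R) -> 'I_3 -> R -> R) : Prop :=
  forall rho, inX rho -> eq01 (A rho) (fun _ _ => 0) -> eq01 rho (fun _ _ => 0).

(* A is an invertible operator on X whose inverse has norm at most B. *)
Definition invertible_onX (A : ('I_3 -> R -> R) -> 'I_3 -> R -> R) (B : R) : Prop :=
  (forall rho, inX rho -> inX (A rho)) /\
  (forall f, inX f -> exists rho,
     [/\ inX rho, eq01 (A rho) f, norm3 rho <= B * norm3 f &
         forall rho', inX rho' -> eq01 (A rho') f -> eq01 rho' rho]).

End Spaces.

Section Discretization.
Context {R : realType}.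

Definition v11 (t : R) : R := t * (1 - t).

Definition orthogonal_v11 (m : nat) (p : {poly R}) : Prop :=
  size p = m.+1 /\
  forall q : {poly R}, (size q <= m)%N ->
    integral01 (fun t => p.[t] * q.[t] * v11 t) = 0.

(* x m 0 < ... < x m m.+1 are the nodes of the Lobatto rule with m interior nodes;
   m increasing roots of a polynomial of degree m are all its zeros. *)
Definition lobatto_nodes (x : nat -> nat -> R) : Prop :=
  forall m : nat,
    [/\ x m 0%N = 0, x m m.+1 = 1,
        (forall h, (0 < h < m)%N -> x m h < x m h.+1) &
        exists2 p, orthogonal_v11 m p & forall h, (0 < h <= m)%N -> root p (x m h)].

Section Rule.
Variables (x : nat -> nat -> R) (m : nat).

Definition lagrange_poly (k : nat) : {poly R} :=
  \prod_(1 <= j < m.+1 | j != k) ((x m k - x m j)^-1 *: ('X - (x m j)%:P)).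

Definition lobatto_weight (h : nat) : R :=
  if (h == 0%N) || (h == m.+1) then ((m.+1)%:R * (m.+2)%:R)^-1
  else integral01 (fun t => (lagrange_poly h).[t] * v11 t / v11 (x m h)).

Definition lobatto (f : R -> R) : R :=
  \sum_(0 <= h < m.+2) lobatto_weight h * f (x m h).

End Rule.

Variables (chi : R) (xi eta : 'I_3 -> R -> R).

Definition threshold (c eps : R) (m : nat) : R := c / m%:R `^ (2 - 2 * eps).

Definition Wtilde (x : nat -> nat -> R) (c eps : R) (m : nat)
    (rho : 'I_3 -> R -> R) (i : 'I_3) (s : R) : R :=
  let th := threshold c eps m in
  let Wm := Wop chi (lobatto x m) rho i in
  if th <= s then Wm s
  else th^-1 * (s * Wm th + (th - s) * Wop chi integral01 rho i 0).

Definition exact_op (rho : 'I_3 -> R -> R) (i : 'I_3) (s : R) : R :=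
  - pi * rho i s + Wop chi integral01 rho i s + Sop chi xi eta integral01 rho i s.

Definition discrete_op (x : nat -> nat -> R) (c eps : R) (m : nat)
    (rho : 'I_3 -> R -> R) (i : 'I_3) (s : R) : R :=
  - pi * rho i s + Wtilde x c eps m rho i s + Sop chi xi eta (lobatto x m) rho i s.

Definition corner_regular (psi : 'I_3 -> R -> R) : Prop :=
  let beta := (1 + `|chi|)^-1 in
  smooth_on I01 (psi arc3) /\
  forall i, i != arc3 ->
    [/\ smooth_on `]0, 1] (psi i),
        exists C : R, forall t, 0 < t <= 1 -> `|psi i t - psi i 0| <= C * t `^ beta &
        forall r : nat, (0 < r)%N -> exists C : R,
          forall t, 0 < t <= 1 -> `|derivn01 r (psi i) t| <= C * t `^ (beta - r%:R)].

Definition double_layer (psi : 'I_3 -> R -> R) (A : R * R) : R :=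
  \sum_(i < 3) integral01 (fun t => H xi eta i A t * psi i t).

Definition discrete_double_layer (x : nat -> nat -> R) (m : nat)
    (psim : 'I_3 -> R -> R) (A : R * R) : R :=
  \sum_(i < 3) lobatto x m (fun t => H xi eta i A t * psim i t).

Definition dist_arc (A : R * R) (i : 'I_3) : R :=
  inf [set dist2 A (xi i t, eta i t) | t in I01].

Definition dist_boundary (A : R * R) : R :=
  Num.min (dist_arc A arc1) (Num.min (dist_arc A arc2) (dist_arc A arc3)).

End Discretization.

(* Main.v *)
Require Import Defs.
From HB Require Import structures.
From mathcomp Require Import all_boot all_order all_algebra.
From mathcomp Require Import all_classical all_reals all_analysis.
From mathcomp Require Import ring lra zify.
Import Order.TTheory GRing.Theory Num.Theory.
Import numFieldNormedType.Exports.
Local Open Scope classical_set_scope.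
Local Open Scope ring_scope.

(** The error splits into the error of the Lobatto rule on the integrands
    [H_i psi_i], and the rule applied to [H_i (psi_i - psi_{m,i})].  For the
    second part, the weights are nonnegative and add up to 1, and [|H_i|] is
    [O(1/d)] because its numerator is [O(r)] and its denominator [r^2], where
    [r >= d] is the distance from [(x, y)] to the point of the arc.

    For the first part, the difficulty is the corner, where [psi_i'] may blow up
    like [t^(beta - 1)].  Since [|chi| < 1] gives [beta > 1/2], this is
    [O(t^(-1/2))], so that [psi_i] is Lipschitz as a function of [sqrt t]
    ([density_sqrt_Lipschitz]).  The kernel is Lipschitz in [t] with a
    constant [O(1/d^2 + 1/d)] ([kernel_Lipschitz]), so the integrand is Lipschitz
    in [sqrt t] with such a constant [Lam].

    With [t = cos(th/2)^2], a function that is Lipschitz in [sqrt t] becomes an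
    even Lipschitz function of the angle [th].  Jackson's theorem ([jackson]) then
    provides a polynomial of degree at most [m] within [3 Lam / m] of the
    integrand.  The Lobatto rule is exact on that polynomial, and positive with
    total mass 1, as is the integral over [[0, 1]]; hence its error is at most
    twice the distance to the polynomial ([lobatto_error]).

    Exactness up to degree [2m + 1] ([lobatto_exact]) is the Gauss property of
    the interior nodes, plus a verification that [1/((m+1)(m+2))] are the right
    weights at the end points; the latter rests on the differential equation
    [(w P)'' = - (m+1)(m+2) P] of the orthogonal polynomial for the weight
    [w = t (1 - t)]. *)

(** * Trigonometric sums over equispaced angles *)

Lemma cosD_cosB (R : realType) (a b : R) :
  cos (a + b) + cos (a - b) = 2 * (cos a * cos b).
Proof. by rewrite cosD cosB; ring. Qed.

Lemma sinD_sinB (R : realType) (a b : R) :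
  sin (a + b) - sin (a - b) = 2 * (sin b * cos a).
Proof. by rewrite sinD sinB; ring. Qed.

(** Up to the change of variable [u = 2 t - 1] these are the Chebyshev polynomials,
    obtained from the recurrence
    [cos ((n+2) th) = 2 cos th cos ((n+1) th) - cos (n th)]. *)
Lemma chebyshev_half (R : realType) (n : nat) :
  exists2 p : {poly R}, (size p <= n.+1)%N &
    forall th : R, p.[(1 + cos th) / 2] = cos (n%:R * th).
Proof.
suff: (exists2 p : {poly R}, (size p <= n.+1)%N &
    forall th : R, p.[(1 + cos th) / 2] = cos (n%:R * th)) /\
  (exists2 p : {poly R}, (size p <= n.+2)%N &
    forall th : R, p.[(1 + cos th) / 2] = cos (n.+1%:R * th)) by case.
elim: n => [|n [[p sp pE] [q sq qE]]]; split.
- exists 1%:P => [|th]; first by rewrite size_polyC oner_eq0.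
  by rewrite hornerC mul0r cos0.
- exists (2 *: 'X - 1%:P) => [|th]; last first.
    by rewrite !hornerE /=; field.
  rewrite (leq_trans (size_polyD _ _))// geq_max size_polyN size_polyC oner_eq0.
  by rewrite (leq_trans (size_scale_leq _ _))// size_polyX.
- by exists q.
- exists ((4 *: 'X - 2%:P) * q - p) => [|th].
    rewrite (leq_trans (size_polyD _ _))// geq_max size_polyN; apply/andP; split.
      apply: leq_trans (size_polyMleq _ _) _.
      have s2 : (size (4 *: 'X - 2%:P : {poly R})%R <= 2)%N.
        rewrite (leq_trans (size_polyD _ _))// geq_max size_polyN.
        rewrite (leq_trans (size_polyC_leq1 _))// andbT.
        by rewrite (leq_trans (size_scale_leq _ _))// size_polyX.
      by rewrite -subn1 leq_subLR; exact: (leq_add s2 sq).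
    exact: leq_trans sp (leqW (leqnSn _)).
  rewrite !hornerE /= pE qE.
  have -> : n.+2%:R * th = n.+1%:R * th + th by rewrite -[n.+2]addn1 natrD; ring.
  have -> : n%:R * th = n.+1%:R * th - th by rewrite -[n.+1]addn1 natrD; ring.
  by have := cosD_cosB _ (n.+1%:R * th) th; lra.
Qed.

(** Multiplied by [2 sin (n pi / N)], which does not vanish, the sum telescopes
    over a full period. *)
Lemma sum_cos_equispaced (R : realType) (N n : nat) (th : R) : (0 < n < N)%N ->
  \sum_(k < N) cos (n%:R * (th - k%:R * (2 * pi / N%:R))) = 0.
Proof.
move=> /andP[n0 nN].
have N0 : N%:R != 0 :> R by rewrite pnatr_eq0; lia.
pose b : R := n%:R * pi / N%:R.
have sb : 0 < sin b.
  apply: sin_gt0_pi; rewrite /b divr_gt0 ?mulr_gt0 ?ltr0n ?pi_gt0//=; last by lia.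
  rewrite ltr_pdivrMr ?ltr0n; last by lia.
  by rewrite mulrC ltr_pM2l ?pi_gt0// ltr_nat.
pose F (k : nat) : R := - sin (n%:R * th + b - 2 * k%:R * b).
apply: (mulfI (lt0r_neq0 sb)); rewrite mulr0; apply: (@mulfI _ 2) => //.
rewrite mulr0 mulr_sumr mulr_sumr.
have -> : \sum_(i < N) 2 * (sin b * cos (n%:R * (th - i%:R * (2 * pi / N%:R)))) =
    \sum_(0 <= k < N) (F k.+1 - F k).
  rewrite big_mkord; apply: eq_bigr => k _; rewrite /F.
  have -> : n%:R * (th - k%:R * (2 * pi / N%:R)) = n%:R * th - 2 * k%:R * b.
    by rewrite /b; field.
  have -> : n%:R * th + b - 2 * k.+1%:R * b = (n%:R * th - 2 * k%:R * b) - b.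
    by rewrite -addn1 natrD; ring.
  have -> : n%:R * th + b - 2 * k%:R * b = (n%:R * th - 2 * k%:R * b) + b by ring.
  by have := sinD_sinB _ (n%:R * th - 2 * k%:R * b) b; lra.
rewrite telescope_sumr// /F.
rewrite -[sin (_ - 2 * N%:R * b)](periodicn (@sinD2pi R) n).
have -> : n%:R * th + b - 2 * N%:R * b + pi *+ 2 *+ n = n%:R * th + b.
  by rewrite /b -mulrnA -[_ *+ (2 * n)]mulr_natr natrM; field.
by rewrite mulr0 mul0r subr0 subrr.
Qed.

Lemma sum_cosB_equispaced (R : realType) (N i j : nat) (th : R) :
  (i < N)%N -> (j < N)%N ->
  \sum_(k < N) cos ((i%:R - j%:R) * (th - k%:R * (2 * pi / N%:R))) =
    if i == j then N%:R else 0.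
Proof.
move=> iN jN; case: (ltngtP i j) => [ij|ij|->].
- have h : (0 < j - i < N)%N by lia.
  rewrite -[RHS](@sum_cos_equispaced _ _ _ th h); apply: eq_bigr => k _.
  by rewrite natrB 1?ltnW// -cosN -mulNr opprB.
- have h : (0 < i - j < N)%N by lia.
  rewrite -[RHS](@sum_cos_equispaced _ _ _ th h); apply: eq_bigr => k _.
  by rewrite natrB 1?ltnW.
- under eq_bigr do rewrite subrr mul0r cos0.
  by rewrite sumr_const card_ord.
Qed.

(** * A positive kernel concentrated at 0 *)

(** Jackson's theorem is proved with sums over equispaced angles in the place of
    convolution integrals: both have the same effect on trigonometric polynomials
    of small degree, and finite sums need no integration theory. *)
Section JacksonKernel.
Context {R : realType}.
Variable M : nat.
Hypothesis M1 : (1 < M)%N.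

(** The coefficients of the Fejer-Korovkin kernel, which is the squared modulus of
    the trigonometric polynomial they define.  [(e_1, ..., e_(M-1))] is the
    eigenvector, for the largest eigenvalue [2 cos (pi/M)], of the adjacency matrix
    of a path; this choice makes the mean of [1 - cos t] against the kernel as small
    as a squared modulus with that many coefficients allows. *)
Definition fejer_coef (j : nat) : R := sin (j%:R * (pi / M%:R)).
Local Notation e := fejer_coef.

Definition fejer_kernel (t : R) : R :=
  \sum_(j < M) \sum_(l < M) e j * e l * cos ((j%:R - l%:R) * t).

Definition fejer_mass : R := \sum_(j < M) e j ^+ 2.

(** One more angle than the [M] frequencies of the kernel: multiplying the kernel by
    [cos] raises them by at most 1, and sums over [M.+1] angles still annihilate all
    the nonzero ones. *)
Definition equinode (k : nat) : R := k%:R * (2 * pi / M.+1%:R).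

(** It is the squared modulus of [\sum_j e_j exp (i j t)]. *)
Lemma fejer_kernel_ge0 (t : R) : 0 <= fejer_kernel t.
Proof.
suff -> : fejer_kernel t =
    (\sum_(j < M) e j * cos (j%:R * t)) ^+ 2 + (\sum_(j < M) e j * sin (j%:R * t)) ^+ 2.
  by rewrite addr_ge0 ?sqr_ge0.
rewrite !expr2 !mulr_suml -big_split; apply: eq_bigr => j _ /=.
rewrite !mulr_sumr -big_split; apply: eq_bigr => l _ /=.
by rewrite mulrBl cosB; ring.
Qed.

Lemma fejer_kernelN (t : R) : fejer_kernel (- t) = fejer_kernel t.
Proof.
apply: eq_bigr => j _; apply: eq_bigr => l _.
by rewrite mulrN cosN.
Qed.

Lemma fejer_mass_gt0 : 0 < fejer_mass.
Proof.
rewrite /fejer_mass (bigD1 (Ordinal M1))//= ltr_pwDl ?sumr_ge0//; last first.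
  by move=> *; rewrite sqr_ge0.
rewrite exprn_gt0// sin_gt0_pi// mul1r divr_gt0 ?pi_gt0 ?ltr0n//=; last by lia.
rewrite ltr_pdivrMr ?ltr0n; last by lia.
by rewrite ltr_pMr ?pi_gt0// ltr1n.
Qed.

Lemma fejer_coefM : e M = 0.
Proof.
rewrite /e mulrC divfK ?sinpi// pnatr_eq0; lia.
Qed.

Lemma sum_ord_delta (F : nat -> R) (j : nat) :
  \sum_(l < M) (if j == l then F l else 0) = if (j < M)%N then F j else 0.
Proof.
rewrite -big_mkcond/=; case: ltnP => jM.
  by rewrite (big_pred1 (Ordinal jM))// => l; rewrite -val_eqE eq_sym.
by rewrite big_pred0// => l; apply/negP => /eqP jl; have := ltn_ord l; lia.
Qed.

Lemma sum_fejer_kernel (th : R) :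
  \sum_(k < M.+1) fejer_kernel (th - equinode k) = M.+1%:R * fejer_mass.
Proof.
rewrite exchange_big mulr_sumr; apply: eq_bigr => j _ /=.
rewrite exchange_big /=.
under eq_bigr => l _.
  rewrite -mulr_sumr.
  rewrite (sum_cosB_equispaced _ _ _ _ th (leqW (ltn_ord j)) (leqW (ltn_ord l))).
  rewrite (fun_if (fun z => e j * e l * z)) mulr0; over.
by rewrite (sum_ord_delta (fun l => e j * e l * M.+1%:R)) ltn_ord; ring.
Qed.

(** Sum of [e_j + e_{j+2} = 2 cos (pi/M) e_{j+1}] against [e_{j+1}], the boundary
    terms being zero as [e_0 = e_M = 0]. *)
Lemma sum_fejer_coef_shift :
  \sum_(j < M) e j * e j.+1 = cos (pi / M%:R) * fejer_mass.
Proof.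
have E (j : nat) : e j + e j.+2 = 2 * (cos (pi / M%:R) * e j.+1).
  rewrite /e.
  have -> : j.+2%:R * (pi / M%:R) = j.+1%:R * (pi / M%:R) + pi / M%:R :> R.
    by rewrite -[j.+2]addn1 natrD; ring.
  have -> : j%:R * (pi / M%:R) = j.+1%:R * (pi / M%:R) - pi / M%:R :> R.
    by rewrite -[j.+1]addn1 natrD; ring.
  by rewrite sinB sinD; ring.
have e0 : e 0 = 0 by rewrite /e mul0r sin0.
have S1 : \sum_(j < M.-1) e j * e j.+1 = \sum_(j < M) e j * e j.+1.
  rewrite -[in RHS](ltn_predK M1) big_ord_recr/= (ltn_predK M1) fejer_coefM.
  by rewrite mulr0 addr0.
have S2 : \sum_(j < M.-1) e j.+2 * e j.+1 = \sum_(j < M) e j * e j.+1.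
  rewrite -[in RHS](ltn_predK M1) big_ord_recl/= e0 mul0r add0r.
  by apply: eq_bigr => j _; rewrite mulrC.
have S0 : fejer_mass = \sum_(j < M.-1) e j.+1 ^+ 2.
  rewrite /fejer_mass -[in LHS](ltn_predK M1) big_ord_recl/= e0 expr0n add0r.
  by apply: eq_bigr.
suff : 2 * (\sum_(j < M) e j * e j.+1) = 2 * (cos (pi / M%:R) * fejer_mass).
  by move/mulfI; apply.
rewrite mulr_natl mulr2n -{1}S1 -S2 -big_split/= S0 !mulr_sumr.
by apply: eq_bigr => j _; rewrite -mulrDl E; ring.
Qed.

(** With [sum_fejer_kernel], this computes the mean of [1 - cos t] against the
    normalized kernel as [1 - cos (pi/M) = O(1/M^2)]: the kernel lives at
    distance [O(1/M)] from 0. *)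
Lemma sum_fejer_kernel_cos (th : R) :
  \sum_(k < M.+1) fejer_kernel (th - equinode k) * cos (th - equinode k) =
    M.+1%:R * (cos (pi / M%:R) * fejer_mass).
Proof.
have E t : fejer_kernel t * cos t =
    (\sum_(j < M) \sum_(l < M) e j * e l * cos ((j.+1%:R - l%:R) * t) +
     \sum_(j < M) \sum_(l < M) e j * e l * cos ((j%:R - l.+1%:R) * t)) / 2.
  rewrite -big_split/= mulr_suml mulr_suml; apply: eq_bigr => j _.
  rewrite -big_split/= mulr_suml mulr_suml; apply: eq_bigr => l _.
  have -> : (j.+1%:R - l%:R) * t = (j%:R - l%:R) * t + t.
    by rewrite -[j.+1]addn1 natrD; ring.
  have -> : (j%:R - l.+1%:R) * t = (j%:R - l%:R) * t - t.
    by rewrite -[l.+1]addn1 natrD; ring.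
  by rewrite -mulrDr cosD_cosB; field.
have S1 : \sum_(k < M.+1) (\sum_(j < M) \sum_(l < M)
      e j * e l * cos ((j.+1%:R - l%:R) * (th - equinode k))) =
    M.+1%:R * \sum_(j < M) e j * e j.+1.
  rewrite exchange_big mulr_sumr; apply: eq_bigr => j _ /=.
  rewrite exchange_big /=.
  under eq_bigr => l _.
    rewrite -mulr_sumr.
    rewrite (@sum_cosB_equispaced _ M.+1 j.+1 l th (ltn_ord j) (leqW (ltn_ord l))).
    rewrite (fun_if (fun z => e j * e l * z)) mulr0; over.
  rewrite (sum_ord_delta (fun l => e j * e l * M.+1%:R)).
  case: ltnP => jM; first ring.
  have -> : j.+1 = M by have := ltn_ord j; lia.
  by rewrite fejer_coefM !mulr0.
have S2 : \sum_(k < M.+1) (\sum_(j < M) \sum_(l < M)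
      e j * e l * cos ((j%:R - l.+1%:R) * (th - equinode k))) =
    M.+1%:R * \sum_(j < M) e j * e j.+1.
  rewrite -S1; apply: eq_bigr => k _; rewrite exchange_big.
  apply: eq_bigr => j _; apply: eq_bigr => l _.
  by rewrite -cosN -mulNr opprB [e l * _]mulrC.
under eq_bigr do rewrite E.
by rewrite -mulr_suml big_split/= S1 S2 sum_fejer_coef_shift; field.
Qed.

End JacksonKernel.

(** * Jackson's theorem for functions Lipschitz in the square root *)

Lemma sin_le_id (R : realType) (x : R) : 0 <= x -> sin x <= x.
Proof.
rewrite le_eqVlt => /predU1P[<-|x0]; first by rewrite sin0.
have cs : {within `[0, x], continuous (@sin R)}.
  exact/continuous_subspaceT/continuous_sin.
have [y _] := MVT x0 (fun y _ => is_derive_sin y) cs.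
rewrite sin0 !subr0 => ->; rewrite -[leRHS]mul1r.
by rewrite ler_wpM2r ?cos_le1// ltW.
Qed.

Lemma onem_cos_le (R : realType) (x : R) : 0 <= x <= pi ->
  1 - cos x <= x ^+ 2 / 2.
Proof.
move=> /andP[x0 xpi].
have -> : x = x / 2 + x / 2 by field.
have s0 : 0 <= sin (x / 2).
  by apply: sin_ge0_pi; apply/andP; split; have := @pi_ge0 R; lra.
have s1 : sin (x / 2) <= x / 2 by apply: sin_le_id; lra.
have := cos2Dsin2 (x / 2).
by rewrite cosD; nra.
Qed.

(** Both sides multiplied by [|cos a| + |cos b|] compare well:
    [cos a ^ 2 - cos b ^ 2 = - sin (a - b) sin (a + b)], and the addition formula
    bounds [|sin (a + b)|] by that factor. *)
Lemma dist_norm_cos (R : realType) (a b : R) :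
  `| `|cos a| - `|cos b| | <= `|sin (a - b)|.
Proof.
have [pq0|pq0] := leP (`|cos a| + `|cos b|) 0.
  have := normr_ge0 (cos a); have := normr_ge0 (cos b) => b0 a0.
  have -> : `|cos a| - `|cos b| = 0 by lra.
  by rewrite normr0.
rewrite -(ler_pM2r pq0) -[X in _ * X <= _](ger0_norm (ltW pq0)) -normrM.
have -> : (`|cos a| - `|cos b|) * (`|cos a| + `|cos b|) =
    - (sin (a - b) * sin (a + b)).
  rewrite sinB sinD -!subr_sqr !real_normK ?num_real// !exprMn !sin2cos2.
  by ring.
rewrite normrN normrM; apply: ler_wpM2l => //.
rewrite sinD (le_trans (ler_normD _ _))// !normrM addrC.
by rewrite lerD ?ler_piMr ?ler_piMl ?sin_max.
Qed.

Section Jackson.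
Context {R : realType}.
Variables (M : nat) (f : R -> R) (Lam : R).
Hypothesis M1 : (1 < M)%N.
Hypothesis Lam0 : 0 <= Lam.
Hypothesis fLip : forall s t : R, I01 s -> I01 t ->
  `|f s - f t| <= Lam * `|Num.sqrt s - Num.sqrt t|.

(** [sqrt ((1 + cos th) / 2) = |cos (th / 2)|], so [f] turns into a Lipschitz
    function of the angle. *)
Let G (th : R) : R := f ((1 + cos th) / 2).

Let G_Lipschitz (a b : R) : `|G a - G b| <= Lam * `|sin ((a - b) / 2)|.
Proof.
have inI (x : R) : I01 ((1 + cos x) / 2).
  by rewrite /I01/= in_itv/=; have := cos_geN1 x; have := cos_le1 x; lra.
have sq (x : R) : Num.sqrt ((1 + cos x) / 2) = `|cos (x / 2)|.
  rewrite -sqrtr_sqr; congr Num.sqrt.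
  rewrite [cos x](_ : _ = cos ((x / 2) *+ 2)); last by congr cos; field.
  by rewrite cos_mulr2n mulr2n; field.
apply: (le_trans (fLip _ _ (inI a) (inI b))).
rewrite ler_wpM2l// !sq (_ : (a - b) / 2 = a / 2 - b / 2); last by field.
exact: dist_norm_cos.
Qed.

Local Notation NS := (M.+1%:R * @fejer_mass R M).

(** The deviation is controlled by the mean of [|sin (t/2)|] against the kernel,
    hence, by the inequality of arithmetic and geometric means, by the mean of
    [sin (t/2) ^ 2 = (1 - cos t) / 2]. *)
Lemma fejer_average (th : R) :
  `|NS * G th - \sum_(k < M.+1)
       fejer_kernel M (th - equinode M k) * G (equinode M k)| <=
  NS * (3 * Lam / M%:R).
Proof.
have M0 : 0 < M%:R :> R by rewrite ltr0n; lia.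
have NS0 : 0 < NS by rewrite mulr_gt0 ?ltr0n ?fejer_mass_gt0.
have term k : `|fejer_kernel M (th - equinode M k) * (G th - G (equinode M k))| <=
    Lam * ((M%:R / 4 + (2 * M%:R)^-1) * fejer_kernel M (th - equinode M k)
     - M%:R / 4 * (fejer_kernel M (th - equinode M k) * cos (th - equinode M k))).
  set t := th - equinode M k.
  have K0 := fejer_kernel_ge0 M t.
  rewrite normrM (ger0_norm K0).
  have := G_Lipschitz th (equinode M k); rewrite -/t => Gt.
  apply: le_trans (ler_wpM2l K0 Gt) _.
  rewrite mulrCA ler_wpM2l//.
  have -> : (M%:R / 4 + (2 * M%:R)^-1) * fejer_kernel M t
      - M%:R / 4 * (fejer_kernel M t * cos t) =
      fejer_kernel M t * (M%:R * ((1 - cos t) / 2) / 2 + (2 * M%:R)^-1).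
    by field; rewrite gt_eqF.
  rewrite ler_wpM2l//.
  have -> : (1 - cos t) / 2 = `|sin (t / 2)| ^+ 2.
    rewrite real_normK ?num_real// sin2cos2.
    rewrite [cos t](_ : _ = cos ((t / 2) *+ 2)); last by congr cos; field.
    by rewrite cos_mulr2n mulr2n; field.
  (* u <= M u^2 / 2 + 1 / (2 M), balanced for u of order 1 / M. *)
  set u := `|sin _|; rewrite -subr_ge0.
  have -> : M%:R * u ^+ 2 / 2 + (2 * M%:R)^-1 - u =
      (M%:R * u - 1) ^+ 2 / (2 * M%:R).
    by field; rewrite gt_eqF.
  by rewrite divr_ge0 ?sqr_ge0// mulr_ge0// ltW.
rewrite -(@sum_fejer_kernel R M M1 th) mulr_suml -sumrB.
under eq_bigr do rewrite -mulrBr.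
apply: le_trans (ler_norm_sum _ _ _) _.
apply: le_trans; first by apply: ler_sum => k _; exact: term.
rewrite -mulr_sumr sumrB -!mulr_sumr sum_fejer_kernel// sum_fejer_kernel_cos//.
set h := cos (pi / M%:R).
have -> : Lam * ((M%:R / 4 + (2 * M%:R)^-1) * NS - M%:R / 4 * (M.+1%:R * (h * fejer_mass M)))
   = NS * (Lam * (M%:R / 4 * (1 - h) + (2 * M%:R)^-1)) by ring.
rewrite ler_wpM2l ?(ltW NS0)// (_ : 3 * Lam / M%:R = Lam * (3 / M%:R)); last by ring.
rewrite ler_wpM2l//.
have hle : 1 - h <= (pi / M%:R) ^+ 2 / 2.
  apply: onem_cos_le; rewrite divr_ge0 ?pi_ge0 ?(ltW M0)//=.
  by rewrite ler_pdivrMr// ler_peMr ?pi_ge0// ler1n; lia.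
(* The crude bound pi < 4 is what leads to the constant 3. *)
have pi4 : (pi : R) ^+ 2 <= 16.
  by have := @pihalf_lt2 R; have := @pi_ge0 R; nra.
have : M%:R / 4 * (1 - h) <= M%:R / 4 * ((pi / M%:R) ^+ 2 / 2).
  by rewrite ler_wpM2l// divr_ge0// ltW.
have -> : M%:R / 4 * ((pi / M%:R) ^+ 2 / 2) = pi ^+ 2 / 8 / M%:R :> R.
  by field; rewrite gt_eqF.
have : (pi : R) ^+ 2 / 8 / M%:R <= 2 / M%:R.
  by rewrite ler_pM2r ?invr_gt0//; lra.
have -> : (2 * M%:R)^-1 = 2^-1 / M%:R :> R by rewrite invfM.
have : 0 < M%:R^-1 :> R by rewrite invr_gt0.
by lra.
Qed.

(** [G] is even, so the average of the kernel means at [th] and at [- th] also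
    approximates it.  That average only contains products
    [cos (j th) cos (j th_k)], hence is a polynomial in [cos th]. *)
Lemma jackson : exists2 p : {poly R}, (size p <= M)%N &
  forall t : R, I01 t -> `|f t - p.[t]| <= 3 * Lam / M%:R.
Proof.
have NS0 : 0 < NS by rewrite mulr_gt0 ?ltr0n ?fejer_mass_gt0.
have := fejer_average; move: NS NS0 => c c0 average.
have /choice[T TE] : forall n : nat, exists p : {poly R}, (size p <= n.+1)%N /\
    forall th : R, p.[(1 + cos th) / 2] = cos (n%:R * th).
  by move=> n; have [p ? ?] := chebyshev_half R n; exists p.
pose e := @fejer_coef R M.
pose d (j l : nat) := (j - l + (l - j))%N.
have cosd (j l : nat) (x : R) : cos ((d j l)%:R * x) = cos ((j%:R - l%:R) * x).
  rewrite /d; case: (leqP j l) => jl.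
    by rewrite (eqP jl) add0n natrB// -cosN -mulNr opprB.
  by have /eqP -> := ltnW jl; rewrite addn0 natrB 1?ltnW.
pose p : {poly R} := \sum_(k < M.+1) \sum_(j < M) \sum_(l < M)
  (c^-1 * G (equinode M k) * (e j * e l * cos ((j%:R - l%:R) * equinode M k))) *:
    T (d j l).
exists p.
  apply: (leq_trans (size_sum _ _ _)); apply/bigmax_leqP => k _.
  apply: (leq_trans (size_sum _ _ _)); apply/bigmax_leqP => j _.
  apply: (leq_trans (size_sum _ _ _)); apply/bigmax_leqP => l _.
  apply: (leq_trans (size_scale_leq _ _)).
  apply: leq_trans (TE _).1 _; rewrite /d.
  by have := ltn_ord j; have := ltn_ord l; lia.
move=> t; rewrite /I01/= in_itv/= => /andP[t0 t1].
pose th := acos (2 * t - 1).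
have -> : t = (1 + cos th) / 2 by rewrite acosK ?in_itv/=; [field|lra].
pose S (th : R) := \sum_(k < M.+1) fejer_kernel M (th - equinode M k) * G (equinode M k).
have -> : p.[(1 + cos th) / 2] = c^-1 * ((S th + S (- th)) / 2).
  rewrite /S -big_split/= mulr_suml mulr_sumr /p horner_sum.
  apply: eq_bigr => k _.
  rewrite [fejer_kernel M (- th - _)](_ : _ = fejer_kernel M (th + equinode M k)); last first.
    by rewrite -fejer_kernelN opprD !opprK.
  rewrite -mulrDl /fejer_kernel -big_split/= !mulr_suml mulr_sumr horner_sum.
  apply: eq_bigr => j _.
  rewrite -big_split/= !mulr_suml mulr_sumr horner_sum.
  apply: eq_bigr => l _.
  rewrite hornerZ (TE _).2 cosd -mulrDr.
  have := cosD_cosB _ ((j%:R - l%:R) * th) ((j%:R - l%:R) * equinode M k).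
  by rewrite -mulrDr -mulrBr addrC => ->; rewrite /e; field; rewrite gt_eqF.
have -> : f ((1 + cos th) / 2) - c^-1 * ((S th + S (- th)) / 2) =
    c^-1 * (((c * G th - S th) + (c * G (- th) - S (- th))) / 2).
  have -> : G (- th) = G th by rewrite /G cosN.
  by rewrite /G; field; rewrite gt_eqF.
have ci : 0 <= c^-1 by rewrite invr_ge0 ltW.
rewrite normrM (ger0_norm ci) ler_pdivrMl//.
rewrite normrM (@ger0_norm _ 2^-1)// ler_pdivrMr//.
apply: le_trans (ler_normD _ _) _.
apply: le_trans (lerD (average th) (average (- th))) _.
lra.
Qed.

End Jackson.

(** * Integrals of polynomials over the unit interval *)

Section PolyIntegral.
Context {R : realType}.
Implicit Types (p q : {poly R}) (f : R -> R).

Lemma integrable_I01 f : {within I01, continuous f} ->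
  (@lebesgue_measure R).-integrable I01 (EFin \o f).
Proof. exact/continuous_compact_integrable/segment_compact. Qed.

Lemma measurable_I01 : measurable (I01 : set R).
Proof. exact: measurable_itv. Qed.

Definition pint p : R := integral01 (horner p).

Lemma within_continuous_horner p (A : set R) : {within A, continuous (horner p)}.
Proof. exact/continuous_subspaceT/continuous_horner. Qed.

Lemma pintD p q : pint (p + q) = pint p + pint q.
Proof.
rewrite -RintegralD; [|exact: measurable_I01
  |exact/integrable_I01/within_continuous_horner..].
by apply: eq_Rintegral => t _; rewrite hornerD.
Qed.

Lemma pintZ (a : R) p : pint (a *: p) = a * pint p.
Proof.
rewrite -RintegralZl; [|exact: measurable_I01
  |exact/integrable_I01/within_continuous_horner].
by apply: eq_Rintegral => t _; rewrite hornerZ.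
Qed.

Lemma pintB p q : pint (p - q) = pint p - pint q.
Proof. by rewrite pintD -scaleN1r pintZ mulN1r. Qed.

Lemma pint_deriv p : pint p^`() = p.[1] - p.[0].
Proof.
rewrite /pint /integral01 /Rintegral (@continuous_FTC2 _ _ (horner p))//.
- exact: within_continuous_horner.
- split.
  + by move=> t _; exact: derivable_horner.
  + exact/cvg_at_right_filter/continuous_horner.
  + exact/cvg_at_left_filter/continuous_horner.
- by move=> t _; rewrite derivE.
Qed.

Lemma pint_deriv_mul p q :
  pint (p^`() * q) = p.[1] * q.[1] - p.[0] * q.[0] - pint (p * q^`()).
Proof. by rewrite -!hornerM -pint_deriv derivM pintD addrK. Qed.

Lemma pint_ge0 p : (forall t, 0 <= t <= 1 -> 0 <= p.[t]) -> 0 <= pint p.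
Proof.
by move=> p0; apply: Rintegral_ge0 => t; rewrite /I01/= in_itv/=; exact: p0.
Qed.

Lemma poly_primitive p : exists q : {poly R}, q^`() = p.
Proof.
exists (\poly_(i < (size p).+1) (if i is j.+1 then p`_j / j.+1%:R else 0)).
apply/polyP => i; rewrite coef_deriv coef_poly ltnS.
case: ltnP => [_|ip]; last by rewrite mul0rn nth_default.
by rewrite -[LHS]mulr_natr divfK ?pnatr_eq0.
Qed.

(** A primitive is nondecreasing with equal values at 0 and 1, hence constant on
    the interval, hence a constant polynomial. *)
Lemma pint_eq0 p : (forall t, 0 <= t <= 1 -> 0 <= p.[t]) -> pint p = 0 -> p = 0.
Proof.
have [q <-] := poly_primitive p => q'0; rewrite pint_deriv => q01.
have mono (s t : R) : 0 <= s -> s <= t -> t <= 1 -> q.[s] <= q.[t].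
  move=> s0 st t1.
  have dq z : z \in `]0, 1[ -> derivable (horner q) z 1.
    by move=> _; exact: derivable_horner.
  have dq0 z : z \in `]0, 1[ -> 0 <= (horner q)^`()%classic z.
    by rewrite in_itv/= => /andP[z0 z1]; rewrite -derivE q'0// !ltW.
  have cq := within_continuous_horner q (`[0, 1] : set R).
  by apply: (ger0_derive1_le_cc dq dq0 cq) => //; rewrite in_itv/=; lra.
have cst (t : R) : 0 <= t <= 1 -> q.[t] = q.[0].
  move=> /andP[t0 t1]; apply/eqP; rewrite eq_le (mono 0 t)// andbT.
  by apply: le_trans (mono _ _ t0 t1 (lexx 1)) _; rewrite -subr_le0 q01.
suff /eqP : q - (q.[0])%:P = 0 by rewrite subr_eq0 => /eqP ->; rewrite derivC.
pose rs := [seq i.+1%:R^-1 : R | i <- iota 0 (size (q - (q.[0])%:P))].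
apply: (@roots_geq_poly_eq0 _ _ rs); last by rewrite size_map size_iota.
- apply/allP => _ /mapP[i _ ->]; rewrite /root hornerD hornerN hornerC cst ?subrr//.
  by rewrite invr_ge0 ler0n invf_le1 ?ltr0n// ler1n.
- rewrite map_inj_uniq ?iota_uniq// => i j /invr_inj /eqP.
  by rewrite eqr_nat eqSS => /eqP.
Qed.

End PolyIntegral.

(** * Exactness and positivity of the Lobatto rule *)

Section LobattoExactness.
Context {R : realType}.
Variables (x : nat -> nat -> R) (m : nat) (P : {poly R}).
Hypothesis m0 : (0 < m)%N.
Hypothesis x0E : x m 0%N = 0.
Hypothesis x1E : x m m.+1 = 1.
Hypothesis xlt : forall h, (0 < h < m)%N -> x m h < x m h.+1.
Hypothesis Porth : orthogonal_v11 m P.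
Hypothesis Proot : forall h, (0 < h <= m)%N -> root P (x m h).

(** Locked, for rewriting with [hornerM] not to see through the product. *)
Definition v11_poly : {poly R} := locked ('X * (1 - 'X)).
Local Notation w := v11_poly.

Lemma v11_polyE : w = 'X * (1 - 'X).
Proof. by rewrite /v11_poly -lock. Qed.

Lemma horner_v11 (t : R) : w.[t] = v11 t.
Proof. by rewrite v11_polyE /v11 !hornerE. Qed.

Lemma v11_ge0 (t : R) : 0 <= t <= 1 -> 0 <= v11 t.
Proof. by move=> /andP[t0 t1]; rewrite mulr_ge0// subr_ge0. Qed.

Lemma size_v11_poly : size w = 3.
Proof.
have -> : w = 'X * - ('X - 1%:P) by rewrite v11_polyE opprB.
by rewrite mulrN size_polyN size_mul ?size_polyX ?size_XsubC ?polyX_eq0 ?polyXsubC_eq0.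
Qed.

Lemma v11_poly_neq0 : w != 0.
Proof. by rewrite -size_poly_gt0 size_v11_poly. Qed.

Lemma size_orthogonal : size P = m.+1. Proof. by case: Porth. Qed.

Lemma orthogonal_neq0 : P != 0. Proof. by rewrite -size_poly_gt0 size_orthogonal. Qed.

Lemma pint_orthogonal (q : {poly R}) : (size q <= m)%N -> pint (P * q * w) = 0.
Proof.
move=> qm; case: Porth => _ /(_ q qm) <-; apply: eq_Rintegral => t _.
by rewrite hornerM horner_v11 hornerM.
Qed.

(** If [P = (X - r) q] with [r] outside of the open interval, then
    [P q w = (X - r) q^2 w] has a constant sign, against orthogonality to [q]. *)
Lemma orthogonal_root_in01 (r : R) : root P r -> 0 < r < 1.
Proof.
move=> /factor_theorem[q Pq].
have q0 : q != 0 by apply/eqP => q0; have := orthogonal_neq0; rewrite Pq q0 mul0r eqxx.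
have sq : (size q <= m)%N.
  have := size_orthogonal; rewrite Pq size_mul ?polyXsubC_eq0// size_XsubC addn2/=.
  by case=> ->.
have /eqP I0 := pint_orthogonal q sq.
have no : ('X - r%:P) * q ^+ 2 * w != 0.
  apply: mulf_neq0 v11_poly_neq0.
  by apply: mulf_neq0; rewrite ?polyXsubC_eq0 ?expf_neq0.
have PE : P * q * w = ('X - r%:P) * q ^+ 2 * w by rewrite Pq; ring.
rewrite PE in I0.
apply/andP; split; rewrite ltNge; apply/negP => r0; move/eqP: no; apply.
- apply: pint_eq0; last exact/eqP.
  move=> t t01; rewrite hornerM horner_v11 hornerM horner_exp hornerXsubC mulr_ge0 ?v11_ge0//.
  by rewrite mulr_ge0 ?sqr_ge0//; lra.
- apply/eqP; rewrite -oppr_eq0; apply/eqP; apply: pint_eq0.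
    move=> t t01; rewrite -!mulNr hornerM horner_v11 hornerM horner_exp.
    by rewrite mulr_ge0 ?v11_ge0// mulr_ge0 ?sqr_ge0// hornerN hornerXsubC; lra.
  by rewrite -scaleN1r pintZ (eqP I0) mulr0.
Qed.

(** The leading terms agree, so the difference [r] of both sides has degree less
    than [m]; two integrations by parts show that it is orthogonal to everything of
    degree less than [m], so to itself. *)
Lemma second_deriv_v11_orthogonal :
  (w * P)^`()^`() = - (m.+1%:R * m.+2%:R) *: P.
Proof.
apply/eqP; rewrite -subr_eq0; set r := _ - _; apply/eqP.
have szwP : (size (w * P)%R <= m.+3)%N.
  by apply: leq_trans (size_polyMleq _ _) _; rewrite size_v11_poly size_orthogonal.
have szr : (size r <= m)%N.
  apply/leq_sizeP => j; rewrite leq_eqVlt => /predU1P[<-|mj].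
    rewrite coefB coefZ !coef_deriv.
    have -> : (w * P)`_m.+2 = - P`_m.
      have -> : w * P = P * 'X - P * 'X * 'X by rewrite v11_polyE; ring.
      by rewrite coefB !coefMX/= nth_default ?size_orthogonal// sub0r.
    by rewrite -mulrnA -[_ *+ (_ * _)]mulr_natr natrM; ring.
  have szd : (size (w * P)^`()^`() <= m.+1)%N.
    apply: leq_trans (size_poly _ _) _; rewrite -subn1 leq_subLR.
    apply: leq_trans (size_poly _ _) _; rewrite -subn1 leq_subLR; exact: szwP.
  by rewrite coefB coefZ !nth_default ?size_orthogonal ?mulr0 ?subrr// (leq_trans szd).
have w0 : w.[0] = 0 by rewrite horner_v11 /v11 mul0r.
have w1 : w.[1] = 0 by rewrite horner_v11 /v11 subrr mulr0.
have szs : (size (r * w)^`()^`() <= m)%N.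
  apply: leq_trans (size_poly _ _) _; rewrite -subn1 leq_subLR.
  apply: leq_trans (size_poly _ _) _; rewrite -subn1 leq_subLR.
  apply: leq_trans (size_polyMleq _ _) _; rewrite size_v11_poly addn3/=.
  by rewrite !add1n !ltnS.
suff I0 : pint (r * r * w) = 0.
  have /eqP : r * r * w = 0.
    apply: pint_eq0 I0 => t t01.
    by rewrite hornerM horner_v11 hornerM mulr_ge0 ?v11_ge0// -expr2 sqr_ge0.
  by rewrite mulf_eq0 (negbTE v11_poly_neq0) orbF mulf_eq0 orbb => /eqP.
rewrite -mulrA {1}/r mulrBl pintB -scalerAl pintZ [P * (r * w)]mulrA pint_orthogonal// mulr0 subr0.
rewrite pint_deriv_mul ![(r * w).[_]]hornerM w0 w1 !mulr0 subr0 sub0r.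
rewrite pint_deriv_mul ![(w * P).[_]]hornerM w0 w1 !mul0r subr0 sub0r opprK.
by rewrite mulrC mulrA [_ * P]mulrC [X in pint X](_ : _ = P * (r * w)^`()^`() * w) ?pint_orthogonal//; ring.
Qed.

(** Replacing [P] by a multiple of [(w P)''] and integrating by parts leaves the
    end values of [(w P)'], which are [P(0)] and [- P(1)].  These two integrals are
    what the rule gives for [X P] and [(1 - X) P], so they pin down its weights at
    the end points. *)
Lemma moments_orthogonal :
  pint ('X * P) = (m.+1%:R * m.+2%:R)^-1 * P.[1] /\
  pint ((1 - 'X) * P) = (m.+1%:R * m.+2%:R)^-1 * P.[0].
Proof.
pose k : R := m.+1%:R * m.+2%:R.
have k0 : k != 0 by rewrite mulf_neq0 ?pnatr_eq0.
have PE : P = - k^-1 *: (w * P)^`()^`().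
  by rewrite second_deriv_v11_orthogonal scalerA mulrNN mulVf ?scale1r.
have w0 : w.[0] = 0 by rewrite horner_v11 /v11 mul0r.
have w1 : w.[1] = 0 by rewrite horner_v11 /v11 subrr mulr0.
have dw : w^`() = 1 - 'X - 'X.
  by rewrite v11_polyE derivM derivB derivX -polyC1 derivC polyC1; ring.
have B1 : (w * P)^`().[1] = - P.[1].
  by rewrite derivM hornerD !hornerM w1 dw !hornerE /=; ring.
have B0 : (w * P)^`().[0] = P.[0].
  by rewrite derivM hornerD !hornerM w0 dw !hornerE /=; ring.
have IB : pint (w * P)^`() = 0.
  by rewrite pint_deriv ![(w * P).[_]]hornerM w0 w1 !mul0r subrr.
have kN (q : {poly R}) : pint (q * P) = - k^-1 * pint ((w * P)^`()^`() * q).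
  by rewrite {1}PE -scalerAr pintZ mulrC [_ * q]mulrC mulrC.
split; rewrite kN pint_deriv_mul B1 B0.
  by rewrite derivX mulr1 IB !hornerX; ring.
rewrite (_ : (w * P)^`() * (1 - 'X)^`() = -1 *: (w * P)^`()); last first.
  by rewrite derivB derivX -polyC1 derivC polyC1 scaleN1r; ring.
rewrite pintZ IB.
by rewrite !hornerE /=; ring.
Qed.

Local Notation lam := (lobatto_weight x m).
Local Notation lag := (lagrange_poly x m).

Lemma node_in01 (k : nat) : (0 < k <= m)%N -> 0 < x m k < 1.
Proof. by move=> km; exact/orthogonal_root_in01/Proot. Qed.

Lemma node_I01 (k : nat) : (k <= m.+1)%N -> I01 (x m k).
Proof.
rewrite /I01/= in_itv/= leq_eqVlt => /predU1P[->|km]; first by rewrite x1E ler01 lexx.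
case: k km => [_|k km]; first by rewrite x0E lexx ler01.
by have /andP[/ltW -> /ltW ->] := @node_in01 k.+1 km.
Qed.

Lemma node_lt (j k : nat) : (0 < j)%N -> (j < k)%N -> (k <= m)%N -> x m j < x m k.
Proof.
move=> j0; elim: k => // k IH; rewrite ltnS leq_eqVlt => /predU1P[<-|jk] km.
  by apply: xlt; rewrite j0.
by apply: lt_trans (IH jk (ltnW km)) _; apply: xlt; rewrite (leq_ltn_trans _ jk).
Qed.

Lemma node_eq (j k : nat) : (0 < j <= m)%N -> (0 < k <= m)%N ->
  (x m j == x m k) = (j == k).
Proof.
move=> /andP[j0 jm] /andP[k0 km]; apply/eqP/eqP => [|->//].
by case: (ltngtP j k) => // jk; have := node_lt _ _ _ jk; 
  [move=> /(_ j0 km)|move=> /(_ k0 jm)]; move=> h E; rewrite E ltxx in h.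
Qed.

Lemma lagrange_node (k j : nat) : (0 < k <= m)%N -> (0 < j <= m)%N ->
  (lag k).[x m j] = (j == k)%:R.
Proof.
move=> km jm; rewrite horner_prod; case: eqVneq => [->|jk].
  rewrite big_nat_cond big1// => i /andP[im ik].
  by rewrite hornerZ hornerXsubC mulVf// subr_eq0 node_eq// eq_sym.
apply/eqP; rewrite prodf_seq_eq0; apply/hasP; exists j.
  by rewrite mem_index_iota.
by rewrite jk hornerZ hornerXsubC subrr mulr0 /=.
Qed.

Lemma size_lagrange (k : nat) : (0 < k <= m)%N -> (size (lag k) <= m)%N.
Proof.
move=> km; rewrite /lagrange_poly scaler_prod -[X in _ *: X]big_filter.
apply: leq_trans (size_scale_leq _ _) _; rewrite size_prod_XsubC size_filter.
have := count_predC (pred1 k) (index_iota 1 m.+1).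
rewrite count_uniq_mem ?iota_uniq// mem_index_iota ltnS km size_iota subn1 /=.
by move=> E; rewrite -[X in (_ <= X)%N]E add1n ltnS; apply: eq_leq; exact: eq_count.
Qed.

Lemma lagrange_interpolation (r : {poly R}) : (size r <= m)%N ->
  r = \sum_(1 <= k < m.+1) r.[x m k] *: lag k.
Proof.
move=> rm; apply/eqP; rewrite -subr_eq0; set d := r - _; apply/eqP.
apply: (@roots_geq_poly_eq0 _ d [seq x m k | k <- index_iota 1 m.+1]).
- apply/allP => y /mapP[j + ->]; rewrite mem_index_iota ltnS => jm.
  rewrite /root /d hornerD hornerN horner_sum (bigD1_seq j) ?iota_uniq ?mem_index_iota//=.
  rewrite hornerZ lagrange_node// eqxx mulr1 big_nat_cond big1 ?addr0 ?subrr//.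
  by move=> k /andP[km kj]; rewrite hornerZ lagrange_node// eq_sym (negbTE kj) mulr0.
- rewrite map_inj_in_uniq ?iota_uniq// => j k.
  rewrite !mem_index_iota !ltnS => jm km /eqP.
  by rewrite node_eq// => /eqP.
- rewrite size_map size_iota subn1/= /d.
  rewrite (leq_trans (size_polyD _ _))// geq_max rm size_polyN.
  rewrite big_nat; apply: (big_ind (fun q : {poly R} => (size q <= m)%N)).
  + by rewrite size_poly0.
  + by move=> p q pm qm; rewrite (leq_trans (size_polyD _ _))// geq_max pm.
  + move=> k km; rewrite (leq_trans (size_scale_leq _ _))// size_lagrange//.
Qed.

Lemma interior_weight (k : nat) : (0 < k <= m)%N ->
  lam k * v11 (x m k) = pint (lag k * w).
Proof.
move=> km; have /andP[k0 k1] := node_in01 _ km.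
have v0 : v11 (x m k) != 0 by rewrite mulf_neq0 ?subr_eq0 ?gt_eqF.
rewrite /lobatto_weight; have -> : (k == 0%N) || (k == m.+1) = false by lia.
rewrite mulrC -RintegralZl.
- by apply: eq_Rintegral => t _; rewrite hornerM horner_v11; field.
- exact: measurable_I01.
- apply: integrable_I01.
  rewrite (_ : (fun t => _) = horner ((v11 (x m k))^-1 *: (lag k * w))).
    exact: within_continuous_horner.
  by apply/funext => t; rewrite hornerZ hornerM horner_v11 mulrC.
Qed.

(** Division by [P] reduces [q] to its remainder: the quotient is killed by
    orthogonality on the left, and by [P] vanishing at the nodes on the right. *)
Lemma gauss_exact (q : {poly R}) : (size q <= m.*2)%N ->
  pint (q * w) = \sum_(1 <= k < m.+1) lam k * (q * w).[x m k].
Proof.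
move=> qm.
have sa : (size (q %/ P)%R <= m)%N.
  by rewrite size_divp ?orthogonal_neq0// size_orthogonal/= leq_subLR addnn.
have sr : (size (q %% P)%R <= m)%N.
  by rewrite -ltnS -size_orthogonal ltn_modp orthogonal_neq0.
rewrite {1}(divp_eq q P) mulrDl pintD [_ * P]mulrC pint_orthogonal// add0r.
rewrite {1}(lagrange_interpolation _ sr) big_nat_cond mulr_suml.
rewrite (big_morph pint pintD (_ : pint 0 = 0)); last first.
  by rewrite -(scale0r (0 : {poly R})) pintZ mul0r.
rewrite [RHS]big_nat_cond; apply: eq_bigr => k; rewrite andbT ltnS => km.
rewrite -scalerAl pintZ -interior_weight// hornerM horner_v11.
have -> : q.[x m k] = (q %% P).[x m k].
  rewrite {1}(divp_eq q P) hornerD hornerM.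
  by have /eqP -> := Proot _ km; rewrite mulr0 add0r.
by ring.
Qed.

Lemma lobattoD (f g : R -> R) :
  lobatto x m (fun t => f t + g t) = lobatto x m f + lobatto x m g.
Proof.
by rewrite /lobatto -big_split; apply: eq_bigr => h _; rewrite mulrDr.
Qed.

Lemma lobattoZ (a : R) (f : R -> R) :
  lobatto x m (fun t => a * f t) = a * lobatto x m f.
Proof.
by rewrite /lobatto mulr_sumr; apply: eq_bigr => h _; rewrite mulrCA.
Qed.

Lemma lobatto_split (f : R -> R) : lobatto x m f =
  (m.+1%:R * m.+2%:R)^-1 * (f 0 + f 1) + \sum_(1 <= k < m.+1) lam k * f (x m k).
Proof.
have l0 : lam 0%N = (m.+1%:R * m.+2%:R)^-1 by [].
have l1 : lam m.+1 = (m.+1%:R * m.+2%:R)^-1 by rewrite /lobatto_weight eqxx orbT.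
rewrite /lobatto big_nat_recl// big_nat_recr//= x0E x1E l0 l1.
by rewrite [in RHS]big_add1; ring.
Qed.

(** The error vanishes on multiples of [w], so it only depends on the values of the
    polynomial at 0 and 1.  Each of [X P] and [(1 - X) P] vanishes at exactly one of
    these two points, so exactness on both of them is enough. *)
Let err (p : {poly R}) : R := lobatto x m (horner p) - pint p.

Let errD (p q : {poly R}) : err (p + q) = err p + err q.
Proof.
rewrite /err pintD opprD addrACA -lobattoD; congr (_ + _).
by congr lobatto; apply/funext => t; rewrite hornerD.
Qed.

Let errZ (a : R) (p : {poly R}) : err (a *: p) = a * err p.
Proof.
rewrite /err pintZ mulrBr -lobattoZ; congr (_ - _).
by congr lobatto; apply/funext => t; rewrite hornerZ.
Qed.

Let err_v11 (q : {poly R}) : (size q <= m.*2)%N -> err (q * w) = 0.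
Proof.
move=> qm; rewrite /err lobatto_split gauss_exact// !hornerM !horner_v11 /v11.
by rewrite subrr mul0r !mulr0 addr0 mulr0 add0r subrr.
Qed.

Let err_ends (p : {poly R}) : (size p <= m.*2.+2)%N ->
  err p = p.[0] * err (1 - 'X) + p.[1] * err 'X.
Proof.
move=> pm; pose l : {poly R} := p.[0] *: (1 - 'X) + p.[1] *: 'X.
have /factor_theorem[q1 E1] : root (p - l) 0.
  by apply/eqP; rewrite /l !hornerE /=; ring.
have /factor_theorem[q2 E2] : root q1 1.
  have : (p - l).[1] = 0 by rewrite /l !hornerE /=; ring.
  by rewrite E1 hornerM hornerXsubC subr0 mulr1 => /eqP.
have pE : p = - q2 * w + l.
  by rewrite -[LHS](subrK l) E1 E2 v11_polyE; ring.
have sl : (size l <= 2)%N.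
  rewrite (leq_trans (size_polyD _ _))// geq_max.
  rewrite !(leq_trans (size_scale_leq _ _)) ?size_polyX//.
  by rewrite (leq_trans (size_polyD _ _))// geq_max size_polyN size_polyX size_poly1.
have sq : (size (- q2) <= m.*2)%N.
  have : (size (- q2 * w)%R <= m.*2.+2)%N.
    rewrite (_ : - q2 * w = p - l); last by rewrite [in RHS]pE addrK.
    rewrite (leq_trans (size_polyD _ _))// geq_max pm size_polyN.
    by rewrite (leq_trans sl).
  have [->|q0] := eqVneq (- q2) 0; first by rewrite size_poly0.
  by rewrite size_mul ?v11_poly_neq0// size_v11_poly addn3.
by rewrite {1}pE errD err_v11// add0r /l errD !errZ.
Qed.

Lemma lobatto_exact (p : {poly R}) : (size p <= m.*2.+2)%N ->
  lobatto x m (horner p) = pint p.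
Proof.
move=> pm; apply/eqP; rewrite -subr_eq0 -/(err p) err_ends//.
have m2 : (m.+2 <= m.*2.+2)%N by rewrite !ltnS -addnn leq_addr.
have [M1 M0] := moments_orthogonal.
have P0 : P.[0] != 0.
  by apply/negP => /orthogonal_root_in01; rewrite ltxx.
have P1 : P.[1] != 0.
  by apply/negP => /orthogonal_root_in01; rewrite ltxx andbF.
have rootsum (q : {poly R}) :
    \sum_(1 <= k < m.+1) lam k * (q * P).[x m k] = 0.
  rewrite big_nat_cond big1// => k /andP[km _]; rewrite ltnS in km.
  by rewrite hornerM (eqP (Proot _ km)) !mulr0.
have eX : err 'X = 0.
  have : err ('X * P) = 0.
    rewrite /err lobatto_split rootsum addr0 M1 !hornerM !hornerX mul0r add0r mul1r.
    by rewrite subrr.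
  rewrite err_ends; last first.
    by rewrite (leq_trans (size_polyMleq _ _))// size_polyX size_orthogonal.
  rewrite !hornerM !hornerX mul0r mul0r add0r mul1r => /eqP.
  by rewrite mulf_eq0 (negbTE P1) => /eqP.
have eY : err (1 - 'X) = 0.
  have : err ((1 - 'X) * P) = 0.
    rewrite /err lobatto_split rootsum addr0 M0 !hornerM !hornerE /= subrr mul0r.
    by rewrite addr0 subr0 mul1r subrr.
  rewrite err_ends; last first.
    rewrite (leq_trans (size_polyMleq _ _))// size_orthogonal (_ : 1 - 'X = - ('X - 1%:P)).
      by rewrite size_polyN size_XsubC.
    by rewrite opprB.
  rewrite !hornerM !hornerE /= subrr mul0r mul0r addr0 subr0 mul1r => /eqP.
  by rewrite mulf_eq0 (negbTE P0) => /eqP.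
by rewrite eX eY !mulr0 addr0.
Qed.

(** An interior weight is, up to the positive factor [v11 (x m h)], the integral of
    the square of the Lagrange polynomial against [w]. *)
Lemma lobatto_weight_ge0 (h : nat) : (h <= m.+1)%N -> 0 <= lam h.
Proof.
move=> hm; have [/orP e|] := boolP ((h == 0%N) || (h == m.+1)).
  by rewrite /lobatto_weight; move/orP: e => ->; rewrite invr_ge0 mulr_ge0.
move=> he; have {hm}km : (0 < h <= m)%N by lia.
have /andP[h0 h1] := node_in01 _ km.
have v0 : 0 < v11 (x m h) by rewrite mulr_gt0 ?subr_gt0.
rewrite -(pmulr_lge0 _ v0).
have -> : lam h * v11 (x m h) = pint (lag h ^+ 2 * w).
  rewrite gauss_exact; last first.
    apply: leq_trans (leq_pred _).
    rewrite expr2 (leq_trans (size_polyMleq _ _))// -addnn.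
    by have := size_lagrange _ km; lia.
  rewrite (bigD1_seq h) ?iota_uniq ?mem_index_iota//=.
  rewrite hornerM horner_exp lagrange_node// eqxx expr1n mul1r horner_v11.
  rewrite big_nat_cond big1 ?addr0// => k /andP[km' kh].
  by rewrite hornerM horner_exp lagrange_node// (negbTE kh) expr0n/= mul0r mulr0.
apply: pint_ge0 => t t01.
by rewrite hornerM horner_exp horner_v11 mulr_ge0 ?sqr_ge0 ?v11_ge0.
Qed.

Lemma sum_lobatto_weight : \sum_(0 <= h < m.+2) lam h = 1.
Proof.
have := lobatto_exact 1%:P; rewrite size_polyC oner_eq0 => /(_ isT).
rewrite -[1%:P in RHS]derivX pint_deriv !hornerX subr0 => <-.
by apply: eq_bigr => h _; rewrite hornerC mulr1.
Qed.

End LobattoExactness.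

(** The error bound rests on these four properties, not on the formulas for the
    nodes and the weights. *)
Lemma lobatto_rule (R : realType) (x : nat -> nat -> R) (m : nat) :
  lobatto_nodes x -> (0 < m)%N ->
  [/\ forall h, (h <= m.+1)%N -> I01 (x m h),
      forall h, (h <= m.+1)%N -> 0 <= lobatto_weight x m h,
      \sum_(0 <= h < m.+2) lobatto_weight x m h = 1 &
      forall p : {poly R}, (size p <= m.*2.+2)%N ->
        lobatto x m (horner p) = pint p].
Proof.
move=> /(_ m)[x0 x1 xlt [P Porth Proot]] m0; split.
- by move=> h; apply: (node_I01 _ _ P).
- by move=> h; apply: (lobatto_weight_ge0 _ _ P).
- exact: (sum_lobatto_weight _ _ P).
- by move=> p; apply: (lobatto_exact _ _ P).
Qed.

(** * Quadrature error for functions Lipschitz in the square root *)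

Section LobattoError.
Context {R : realType}.

Definition sqrt_Lipschitz (Lam : R) (f : R -> R) : Prop :=
  forall s t : R, I01 s -> I01 t ->
    `|f s - f t| <= Lam * `|Num.sqrt s - Num.sqrt t|.

Lemma sqrt_Lipschitz_continuous (Lam : R) (f : R -> R) :
  sqrt_Lipschitz Lam f -> {within I01, continuous f}.
Proof.
move=> fL; apply/subspace_continuousP => t t01; apply/cvgrPdist_le => e e0.
have L0 : 0 < `|Lam| + 1 by rewrite ltr_wpDl.
have := @sqrt_continuous R t => /cvgrPdist_le /(_ (e / (`|Lam| + 1))).
rewrite divr_gt0// => /(_ isT) near_t.
rewrite near_withinE; apply: filterS near_t => s; rewrite ler_pdivlMr// => st s01.
apply: le_trans (fL _ _ t01 s01) _; apply: le_trans st.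
rewrite mulrC ler_wpM2l// (le_trans (ler_norm _))// lerDl//.
Qed.

(** Integral and rule agree on the polynomial of [jackson] and are both averages,
    so each contributes once the distance of [f] to that polynomial. *)
Lemma lobatto_error (x : nat -> nat -> R) (m : nat) (f : R -> R) (Lam : R) :
  lobatto_nodes x -> (0 < m)%N -> 0 <= Lam -> sqrt_Lipschitz Lam f ->
  `|integral01 f - lobatto x m f| <= 6 * Lam / m%:R.
Proof.
move=> nodes m0 Lam0 fL; have [x01 w0 w1 exact] := lobatto_rule _ _ _ nodes m0.
have M1 : (1 < m.+1)%N by [].
have [p sp pf] := jackson _ _ _ M1 Lam0 fL.
have Qp : lobatto x m (horner p) = integral01 (horner p).
  apply: exact.
  by apply: leq_trans sp _; rewrite !ltnS -addnn leqW// leq_addr.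
set e := 3 * Lam / m.+1%:R in pf.
have Ie : `|integral01 f - integral01 (horner p)| <= e.
  have cf := sqrt_Lipschitz_continuous _ _ fL.
  have cp := within_continuous_horner p I01.
  have cfp : {within I01, continuous (fun t => f t - p.[t])}.
    by move=> t; apply: cvgB; [exact: cf|exact: cp].
  rewrite -RintegralB; [|exact: measurable_I01|exact: integrable_I01..].
  apply: le_trans; first by apply: le_normr_Rintegral;
    [exact: measurable_I01|exact: integrable_I01].
  have -> : e = integral01 (fun=> e).
    have := pint_deriv (e *: 'X).
    rewrite derivZ derivX !hornerZ !hornerX mulr1 mulr0 subr0 => {1}<-.
    by apply: eq_Rintegral => t _; rewrite hornerZ hornerC mulr1.
  apply: le_Rintegral => //; first exact: measurable_I01.
  - apply: integrable_I01 => t; apply: cvg_norm.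
    exact: cfp.
  - by apply: integrable_I01 => t; exact: cvg_cst.
have Qe : `|lobatto x m f - lobatto x m (horner p)| <= e.
  rewrite /lobatto -sumrB; apply: le_trans (ler_norm_sum _ _ _) _.
  rewrite -[leRHS]mul1r -w1 mulr_suml.
  rewrite !big_nat; apply: ler_sum => h /= hm.
  have l0 := w0 _ hm.
  rewrite -mulrBr normrM (ger0_norm l0) ler_wpM2l//.
  by apply: pf; apply: x01.
have -> : integral01 f - lobatto x m f =
    (integral01 f - integral01 (horner p)) - (lobatto x m f - lobatto x m (horner p)).
  by rewrite Qp; ring.
apply: le_trans (ler_normB _ _) _; apply: le_trans (lerD Ie Qe) _.
have -> : e + e = 6 * Lam / m.+1%:R by rewrite /e; ring.
by rewrite ler_wpM2l ?mulr_ge0// lef_pV2 ?posrE ?ltr0n// ler_nat.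
Qed.

End LobattoError.

(** * Mean value inequality for one-sided derivatives *)

Section OneSidedDerivative.
Context {R : realType}.
Implicit Types (f g : R -> R).

Lemma derivable01_is_derive f (t : R) : 0 < t < 1 -> derivable01 f t ->
  is_derive t 1 f (deriv01 f t).
Proof.
move=> t01 /cvgrPdist_le; rewrite -/(deriv01 f t) => dq.
suff qt : h^-1 *: (f (h *: 1 + t) - f t) @[h --> 0^'] --> deriv01 f t.
  by apply: DeriveDef; [apply/cvgP: qt|exact: cvg_lim qt].
apply/cvgrPdist_le => e e0; have := dq e e0.
have : \forall s \near t, I01 s.
  have : \forall s \near t, s \in `]0, 1[.
    by apply: near_in_itvoo; rewrite in_itv.
  by apply: filterS => s; rewrite /I01/= !in_itv/= => /andP[/ltW -> /ltW ->].
move=> tI ntq.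
have : \forall s \near t, s != t -> `|deriv01 f t - (f s - f t) / (s - t)| <= e.
  have : \forall s \near t, s != t -> I01 s -> `|deriv01 f t - (f s - f t) / (s - t)| <= e.
    exact: ntq.
  by move=> H; apply: filterS2 tI H => s s01 + st; apply.
move=> /nbhs0P; rewrite /dnbhs near_withinE; apply: filterS => h + h0.
have th0 : t + h != t by rewrite -subr_eq0 addrC addKr.
move=> /(_ th0); rewrite [t + h - t]addrC addKr /= [h *: 1]mulr1 [h + t]addrC.
by rewrite [h^-1 *: _]mulrC.
Qed.

(** A bound on the difference quotient near [t] is a local Lipschitz bound. *)
Lemma derivable01_continuous f (t : R) : I01 t -> derivable01 f t ->
  f @ within I01 (nbhs t) --> f t.
Proof.
move=> t01 /cvgrPdist_le; rewrite -/(deriv01 f t) => /(_ 1 ltr01).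
move=> q1.
have q1' : \forall s \near t, I01 s -> `|f t - f s| <= (`|deriv01 f t| + 1) * `|t - s|.
  have : \forall s \near t, s != t -> I01 s ->
      `|deriv01 f t - (f s - f t) / (s - t)| <= 1 by exact: q1.
  apply: filterS => s; have [-> _ _|st H s01] := eqVneq s t.
    by rewrite !subrr normr0 mulr0.
  have := H isT s01; set d := deriv01 f t; set q := _ / _ => dq.
  have -> : f t - f s = q * (t - s) by rewrite /q -[t - s]opprB mulrN divfK ?opprB// subr_eq0.
  rewrite normrM ler_wpM2r// (_ : q = d - (d - q)); last by ring.
  by rewrite (le_trans (ler_normB _ _))// lerD2l.
apply/cvgrPdist_le => e e0; rewrite near_withinE.
have d0 : 0 < `|deriv01 f t| + 1 by rewrite ltr_wpDl.
have : \forall s \near t, `|t - s| <= e / (`|deriv01 f t| + 1).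
  have /cvgrPdist_le near_t : id @ t --> t by exact: cvg_id.
  by apply: near_t; rewrite divr_gt0.
apply: filterS2 q1' => s H st s01; apply: le_trans (H s01) _.
by rewrite mulrC -ler_pdivlMr.
Qed.

Lemma derivable01_within_continuous f :
  (forall t, I01 t -> derivable01 f t) -> {within I01, continuous f}.
Proof.
move=> df; apply/subspace_continuousP => t t01.
exact: derivable01_continuous (df t t01).
Qed.

(** The comparison function [g] is the identity for the arcs and the square root for
    the densities; in both cases this is Cauchy's mean value theorem. *)
Lemma mean_value_le f g (df dg : R -> R) (K : R) :
  {within I01, continuous f} -> {within I01, continuous g} ->
  (forall t : R, 0 < t < 1 -> is_derive t 1 f (df t)) ->
  (forall t : R, 0 < t < 1 -> is_derive t 1 g (dg t)) ->
  (forall t : R, 0 < t < 1 -> 0 < dg t) ->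
  (forall t : R, 0 < t < 1 -> `|df t| <= K * dg t) ->
  forall s t : R, I01 s -> I01 t -> `|f s - f t| <= K * `|g s - g t|.
Proof.
move=> cf cg fdf gdg dg0 dfK s t.
wlog st : s t / t <= s.
  move=> W s01 t01; have [ts|/ltW st] := leP t s; first exact: W.
  by rewrite distrC [`|g s - _|]distrC; exact: W.
rewrite /I01/= !in_itv/= => /andP[s0 s1] /andP[t0 t1].
move: st; rewrite le_eqVlt => /predU1P[->|ts]; first by rewrite !subrr normr0 mulr0.
have sub : (`[t, s] : set R) `<=` I01.
  by move=> z; rewrite /I01/= !in_itv/= => /andP[? ?]; apply/andP; split; lra.
have in01 z : z \in `]t, s[ -> 0 < z < 1.
  by rewrite in_itv/= => /andP[? ?]; apply/andP; split; lra.
have dgn0 z : z \in `]t, s[ -> dg z != 0 by move=> /in01 /dg0 /lt0r_neq0.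
have cft := continuous_subspaceW sub cf; have cgt := continuous_subspaceW sub cg.
have F z (zts : z \in `]t, s[) := fdf z (in01 z zts).
have G z (zts : z \in `]t, s[) := gdg z (in01 z zts).
have gn0 := differentiable_subr_neq0 ts cgt G dgn0.
have [c cts E] := cauchy_MVT ts cft cgt F G dgn0.
have c01 := in01 _ cts.
have -> : f s - f t = df c / dg c * (g s - g t) by rewrite E divfK.
rewrite normrM ler_wpM2r// normrM normfV (gtr0_norm (dg0 _ c01)).
by rewrite ler_pdivrMr ?dg0// dfK.
Qed.

End OneSidedDerivative.

(** * Regularity of the arcs and of the densities *)

Section Densities.
Context {R : realType}.

Lemma within_continuous_bounded (f : R -> R) : {within I01, continuous f} ->
  exists2 B : R, 0 <= B & forall t, I01 t -> `|f t| <= B.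
Proof.
move=> cf; have := continuous_compact cf (@segment_compact R 0 1).
move=> /compact_bounded[M [_ fM]]; exists (`|M| + 1); first by rewrite addr_ge0.
move=> t t01; apply: fM; last by exists t.
by rewrite (le_lt_trans (ler_norm M))// ltrDl.
Qed.

Lemma I01_oo (t : R) : 0 < t < 1 -> I01 t.
Proof. by move=> /andP[t0 t1]; rewrite /I01/= in_itv/= !ltW. Qed.

Definition C1_Lipschitz (V : R) (f : R -> R) : Prop :=
  forall s t : R, I01 s -> I01 t ->
    [/\ `|deriv01 f t| <= V, `|f s - f t| <= V * `|s - t| &
        `|deriv01 f s - deriv01 f t| <= V * `|s - t|].

Lemma C1_Lipschitz_le (V W : R) (f : R -> R) :
  V <= W -> C1_Lipschitz V f -> C1_Lipschitz W f.
Proof.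
move=> VW fV s t s01 t01; have [f1 f2 f3] := fV _ _ s01 t01.
by split; [exact: le_trans VW|exact: le_trans f2 (ler_wpM2r _ VW)
  |exact: le_trans f3 (ler_wpM2r _ VW)].
Qed.

Lemma C2_on_Lipschitz (f : R -> R) : C2_on I01 f ->
  exists2 V : R, 0 <= V & C1_Lipschitz V f.
Proof.
move=> [df ddf c2]; have cf := derivable01_within_continuous _ df.
have c1 := derivable01_within_continuous _ ddf.
have [V1 V10 V1b] := within_continuous_bounded _ c1.
have [V2 V20 V2b] := within_continuous_bounded _ c2.
have cid : {within I01, continuous (@id R)} by apply: continuous_subspaceT => t; exact: cvg_id.
exists (V1 + V2) => [|s t s01 t01]; first exact: addr_ge0.
split.
- by apply: le_trans (V1b t t01) _; rewrite lerDl.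
- apply: (mean_value_le f id (deriv01 f) (fun=> 1)) => // u u01.
  + by apply: derivable01_is_derive => //; apply/df/I01_oo.
  + by rewrite mulr1 (le_trans (V1b _ (I01_oo _ u01)))// lerDl.
- apply: (mean_value_le _ id (deriv01 (deriv01 f)) (fun=> 1)) => // u u01.
  + by apply: derivable01_is_derive => //; apply/ddf/I01_oo.
  + by rewrite mulr1 (le_trans (V2b _ (I01_oo _ u01)))// lerDr.
Qed.

Lemma sqrt_Lipschitz_deriv01 (f : R -> R) (K : R) : {within I01, continuous f} ->
  (forall t, 0 < t < 1 -> derivable01 f t) ->
  (forall t, 0 < t < 1 -> `|deriv01 f t| <= K / Num.sqrt t) ->
  sqrt_Lipschitz (2 * K) f.
Proof.
move=> cf df dfK; apply: (mean_value_le f Num.sqrt (deriv01 f)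
  (fun t => (2 * Num.sqrt t)^-1)) => //.
- by apply: continuous_subspaceT => t; exact: sqrt_continuous.
- by move=> t t01; apply: derivable01_is_derive => //; exact: df.
- by move=> t /andP[t0 _]; exact: is_derive1_sqrt.
- by move=> t /andP[t0 _]; rewrite invr_gt0 mulr_gt0 ?sqrtr_gt0.
- move=> t t01; apply: le_trans (dfK t t01) _; move: t01 => /andP[t0 _].
  rewrite le_eqVlt; apply/orP; left; apply/eqP; field.
  by rewrite gt_eqF ?sqrtr_gt0.
Qed.

(** On the two arcs meeting at the corner, [(1 + |chi|)^-1 >= 1/2], so
    [t^(beta - 1) <= t^(-1/2)], which up to a factor is the derivative of the square
    root. *)
Lemma density_sqrt_Lipschitz (chi : R) (psi : 'I_3 -> R -> R) (i : 'I_3) :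
  -1 < chi < 1 -> inX psi -> corner_regular chi psi ->
  exists2 K : R, 0 <= K & sqrt_Lipschitz K (psi i).
Proof.
move=> chi1 [cpsi _] [smooth3 smooth12].
have [->|i3] := eqVneq i arc3.
  have cd : {within I01, continuous (deriv01 (psi arc3))}.
    by apply: derivable01_within_continuous => t t01; exact: (smooth3 1%N).
  have [B B0 dB] := within_continuous_bounded _ cd.
  exists (2 * B); first by rewrite mulr_ge0.
  apply: sqrt_Lipschitz_deriv01 => // t t01; first exact: (smooth3 0%N _ (I01_oo _ t01)).
  apply: le_trans (dB _ (I01_oo _ t01)) _; move: t01 => /andP[t0 t1].
  by rewrite ler_peMr// invf_ge1 ?sqrtr_gt0// -[leRHS]sqrtr1 ler_wsqrtr// ltW.
have [smi _ /(_ 1%N isT)[C dC]] := smooth12 i i3.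
exists (2 * `|C|); first by rewrite mulr_ge0.
apply: sqrt_Lipschitz_deriv01 => // t /andP[t0 t1].
  by apply: (smi 0%N); rewrite /= in_itv/= t0 ltW.
have t01 : 0 < t <= 1 by rewrite t0 ltW.
apply: le_trans (dC t t01) _.
apply: (@le_trans _ _ (`|C| * t `^ ((1 + `|chi|)^-1 - 1))).
  by rewrite ler_wpM2r ?powR_ge0 ?ler_norm.
rewrite ler_wpM2l// -powR12_sqrt ?(ltW t0)// -powRN ger_powR//.
have c1 : `|chi| < 1 by rewrite ltr_norml.
have : 2^-1 <= (1 + `|chi|)^-1.
  by rewrite lef_pV2 ?posrE ?ltr_wpDr//; lra.
lra.
Qed.

End Densities.

(** * Bounds on the double layer kernel *)

(** The point [A] may be far from the arc, so the numerator and the denominator of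
    the kernel are not bounded separately by constants: the numerator is compared
    with the distance [r] to the moving point, and only powers of [1 / r] that
    remain after cancellation are replaced by powers of [1 / d]. *)
Section DoubleLayerKernel.
Context {R : realType}.
Variables (xi eta : 'I_3 -> R -> R) (i : 'I_3) (V : R).
Hypothesis V0 : 0 <= V.
Hypothesis xiV : C1_Lipschitz V (xi i).
Hypothesis etaV : C1_Lipschitz V (eta i).
Variables (A : R * R) (d : R).
Hypothesis d0 : 0 < d.
Hypothesis dA : forall t, I01 t -> d <= dist2 A (xi i t, eta i t).

Local Notation a1 t := (A.1 - xi i t).
Local Notation a2 t := (A.2 - eta i t).
Local Notation r t := (dist2 A (xi i t, eta i t)).
Let N (t : R) : R := deriv01 (eta i) t * a1 t - deriv01 (xi i) t * a2 t.

Lemma dist2_sqr (P Q : R * R) : dist2 P Q ^+ 2 = (P.1 - Q.1) ^+ 2 + (P.2 - Q.2) ^+ 2.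
Proof. by rewrite sqr_sqrtr// addr_ge0 ?sqr_ge0. Qed.

Lemma dist2_ge (P Q : R * R) :
  `|P.1 - Q.1| <= dist2 P Q /\ `|P.2 - Q.2| <= dist2 P Q.
Proof.
by split; rewrite -sqrtr_sqr ler_wsqrtr// ?lerDl ?lerDr sqr_ge0.
Qed.

Lemma norm_omega (j : 'I_3) : `|omega j : R| = 1.
Proof. by rewrite /omega; case: ifP; rewrite ?normrN normr1. Qed.

Lemma kernelE (t : R) : H xi eta i A t = omega i * (N t / r t ^+ 2).
Proof. by rewrite dist2_sqr. Qed.

Lemma numerator_le (t : R) : I01 t -> `|N t| <= 2 * V * r t.
Proof.
move=> t01; have [x1 _ _] := xiV _ _ t01 t01; have [y1 _ _] := etaV _ _ t01 t01.
have [b1 b2] := dist2_ge A (xi i t, eta i t); rewrite /= in b1 b2.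
apply: le_trans (ler_normB _ _) _; rewrite !normrM.
have -> : 2 * V * r t = V * r t + V * r t by ring.
by rewrite lerD// ler_pM.
Qed.

Lemma kernel_le (t : R) : I01 t -> `|H xi eta i A t| <= 2 * V / d.
Proof.
move=> t01; have dr := dA _ t01; have r0 := lt_le_trans d0 dr.
rewrite kernelE normrM norm_omega mul1r normrM normfV normrX (gtr0_norm r0).
rewrite ler_pdivrMr ?exprn_gt0//; apply: le_trans (numerator_le _ t01) _.
rewrite -!mulrA !ler_wpM2l// mulrC ler_pdivlMr// expr2 ler_wpM2l// ltW//.
Qed.

(** In
    [N_s/r_s^2 - N_t/r_t^2 = (N_s - N_t)/r_s^2 - N_t (r_s^2 - r_t^2)/(r_s r_t)^2],
    [N_s - N_t] is [O(r_s + 1)] and [r_s^2 - r_t^2] is [O(r_s + r_t)], both times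
    [|s - t|]. *)
Lemma kernel_Lipschitz (s t : R) : I01 s -> I01 t ->
  `|H xi eta i A s - H xi eta i A t| <=
  (2 * V / d + 10 * V ^+ 2 / d ^+ 2) * `|s - t|.
Proof.
move=> s01 t01.
have ds := dA _ s01; have rs0 := lt_le_trans d0 ds.
have dt := dA _ t01; have rt0 := lt_le_trans d0 dt.
have [x1 x2 x3] := xiV _ _ s01 t01; have [y1 y2 y3] := etaV _ _ s01 t01.
have [bs1 bs2] := dist2_ge A (xi i s, eta i s); rewrite /= in bs1 bs2.
have [bt1 bt2] := dist2_ge A (xi i t, eta i t); rewrite /= in bt1 bt2.
set e := `|s - t| in x2 x3 y2 y3 *; have e0 : 0 <= e by exact: normr_ge0.
have Ve : 0 <= V * e by exact: mulr_ge0.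
have A1 : `|a1 s - a1 t| <= V * e by rewrite opprB addrC addrA subrK distrC.
have A2 : `|a2 s - a2 t| <= V * e by rewrite opprB addrC addrA subrK distrC.
have NN : `|N s - N t| <= 2 * V * e * (r s + V).
  have -> : N s - N t =
      ((deriv01 (eta i) s - deriv01 (eta i) t) * a1 s
        + deriv01 (eta i) t * (a1 s - a1 t)) -
      ((deriv01 (xi i) s - deriv01 (xi i) t) * a2 s
        + deriv01 (xi i) t * (a2 s - a2 t)) by rewrite /N; ring.
  have -> : 2 * V * e * (r s + V) =
    (V * e * r s + V * (V * e)) + (V * e * r s + V * (V * e)) by ring.
  apply: le_trans (ler_normB _ _) _.
  by apply: lerD; apply: le_trans (ler_normD _ _) _; rewrite !normrM lerD// ler_pM.
have RR : `|r s ^+ 2 - r t ^+ 2| <= 2 * V * e * (r s + r t).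
  rewrite !dist2_sqr/=.
  have -> : a1 s ^+ 2 + a2 s ^+ 2 - (a1 t ^+ 2 + a2 t ^+ 2) =
     (a1 s - a1 t) * (a1 s + a1 t) + (a2 s - a2 t) * (a2 s + a2 t) by ring.
  apply: le_trans (ler_normD _ _) _; rewrite !normrM.
  have -> : 2 * V * e * (r s + r t) = V * e * (r s + r t) + V * e * (r s + r t) by ring.
  by rewrite lerD// ler_pM// (le_trans (ler_normD _ _))// lerD.
have is0 : 0 < (r s)^-1 by rewrite invr_gt0.
have it0 : 0 < (r t)^-1 by rewrite invr_gt0.
have isd : (r s)^-1 <= d^-1 by rewrite lef_pV2.
have itd : (r t)^-1 <= d^-1 by rewrite lef_pV2.
have -> : H xi eta i A s - H xi eta i A t = omega i *
    ((N s - N t) * (r s)^-1 ^+ 2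
     - N t * (r s ^+ 2 - r t ^+ 2) * ((r s)^-1 * (r t)^-1) ^+ 2).
  by rewrite !kernelE; field; rewrite !gt_eqF.
rewrite normrM norm_omega mul1r; apply: le_trans (ler_normB _ _) _.
have T1 : `|(N s - N t) * (r s)^-1 ^+ 2| <= 2 * V * e * (d^-1 + V * d^-1 ^+ 2).
  rewrite normrM [`|_^-1 ^+ 2|]ger0_norm ?sqr_ge0//.
  apply: (@le_trans _ _ (2 * V * e * (r s + V) * (r s)^-1 ^+ 2)).
    by rewrite ler_wpM2r ?sqr_ge0.
  rewrite -mulrA ler_wpM2l -?mulrA ?mulr_ge0//.
  have -> : (r s + V) * (r s)^-1 ^+ 2 = (r s)^-1 + V * (r s)^-1 ^+ 2.
    by field; rewrite gt_eqF.
  by rewrite lerD// ler_wpM2l// ler_sqr ?nnegrE ?(ltW is0) ?invr_ge0 ?(ltW d0).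
have T2 : `|N t * (r s ^+ 2 - r t ^+ 2) * ((r s)^-1 * (r t)^-1) ^+ 2| <=
    8 * V ^+ 2 * e * d^-1 ^+ 2.
  rewrite normrM [`|_ ^+ 2|]ger0_norm ?sqr_ge0//.
  apply: (@le_trans _ _ (2 * V * r t * (2 * V * e * (r s + r t)) *
      ((r s)^-1 * (r t)^-1) ^+ 2)).
    by rewrite ler_wpM2r ?sqr_ge0// normrM ler_pM// numerator_le.
  have -> : 2 * V * r t * (2 * V * e * (r s + r t)) * ((r s)^-1 * (r t)^-1) ^+ 2 =
     4 * V ^+ 2 * e * ((r s)^-1 * (r t)^-1 + (r s)^-1 * (r s)^-1).
    by field; rewrite !gt_eqF.
  have -> : 8 * V ^+ 2 * e * d^-1 ^+ 2 = 4 * V ^+ 2 * e * (d^-1 * d^-1 + d^-1 * d^-1).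
    by ring.
  rewrite ler_wpM2l ?mulr_ge0 ?sqr_ge0//.
  by rewrite lerD// ler_pM// ltW.
apply: le_trans (lerD T1 T2) _; rewrite le_eqVlt; apply/orP; left; apply/eqP.
by field; rewrite gt_eqF.
Qed.

Lemma kernel_density_sqrt_Lipschitz (rho : R -> R) (K B : R) :
  0 <= K -> 0 <= B -> sqrt_Lipschitz K rho -> (forall t, I01 t -> `|rho t| <= B) ->
  sqrt_Lipschitz ((4 * V * B + 20 * V ^+ 2 * B + 2 * V * K) * (1 / d ^+ 2 + 1 / d))
    (fun t => H xi eta i A t * rho t).
Proof.
move=> K0 B0 rhoK rhoB s t s01 t01.
set D := `|Num.sqrt s - Num.sqrt t|; have D0 : 0 <= D by exact: normr_ge0.
have stD : `|s - t| <= 2 * D.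
  have := s01; have := t01; rewrite /I01/= !in_itv/= => /andP[t0 t1] /andP[s0 s1].
  rewrite -{1}(sqr_sqrtr s0) -{1}(sqr_sqrtr t0) subr_sqr normrM mulrC ler_wpM2r//.
  rewrite ger0_norm ?addr_ge0 ?sqrtr_ge0//.
  have : Num.sqrt s <= 1 by rewrite -sqrtr1 ler_wsqrtr.
  have : Num.sqrt t <= 1 by rewrite -sqrtr1 ler_wsqrtr.
  lra.
have -> : H xi eta i A s * rho s - H xi eta i A t * rho t =
   (H xi eta i A s - H xi eta i A t) * rho s + H xi eta i A t * (rho s - rho t) by ring.
apply: le_trans (ler_normD _ _) _.
have di : 0 < d^-1 by rewrite invr_gt0.
have c0 : 0 <= 2 * V / d + 10 * V ^+ 2 / d ^+ 2.
  by rewrite addr_ge0 ?divr_ge0 ?mulr_ge0 ?sqr_ge0// ltW.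
have T1 : `|(H xi eta i A s - H xi eta i A t) * rho s| <=
    (2 * V / d + 10 * V ^+ 2 / d ^+ 2) * (2 * D) * B.
  rewrite normrM ler_pM ?rhoB// (le_trans (kernel_Lipschitz _ _ s01 t01))//.
  by rewrite ler_wpM2l.
have T2 : `|H xi eta i A t * (rho s - rho t)| <= 2 * V / d * (K * D).
  by rewrite normrM ler_pM ?kernel_le ?rhoK.
apply: le_trans (lerD T1 T2) _; rewrite -subr_ge0.
have -> : (4 * V * B + 20 * V ^+ 2 * B + 2 * V * K) * (1 / d ^+ 2 + 1 / d) * D -
  ((2 * V / d + 10 * V ^+ 2 / d ^+ 2) * (2 * D) * B + 2 * V / d * (K * D)) =
  D * (4 * V * B * d^-1 ^+ 2 + 20 * V ^+ 2 * B * d^-1 + 2 * V * K * d^-1 ^+ 2).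
  by field; rewrite gt_eqF.
by rewrite mulr_ge0// !addr_ge0 ?mulr_ge0 ?sqr_ge0// ltW.
Qed.

End DoubleLayerKernel.

(** * The potentials *)

Lemma arc_potential_error (R : realType) (xi eta : 'I_3 -> R -> R)
    (x : nat -> nat -> R) (i : 'I_3) (rho : R -> R) (K : R) :
  C2_on I01 (xi i) -> C2_on I01 (eta i) -> lobatto_nodes x ->
  0 <= K -> sqrt_Lipschitz K rho ->
  exists C C' : R, [/\ 0 <= C, 0 <= C' &
    forall (A : R * R) (d : R) (m : nat) (rhom : R -> R) (e : R),
      0 < d -> (forall t, I01 t -> d <= dist2 A (xi i t, eta i t)) -> (0 < m)%N ->
      (forall t, I01 t -> `|rho t - rhom t| <= e) ->
      `|integral01 (fun t => H xi eta i A t * rho t) -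
        lobatto x m (fun t => H xi eta i A t * rhom t)| <=
      C / m%:R * (1 / d ^+ 2 + 1 / d) + C' / d * e].
Proof.
move=> /C2_on_Lipschitz[V1 V10 xiV] /C2_on_Lipschitz[V2 V20 etaV] nodes K0 rhoK.
pose V := V1 + V2; have V0 : 0 <= V by exact: addr_ge0.
have [B B0 rhoB] := within_continuous_bounded _ (sqrt_Lipschitz_continuous _ _ rhoK).
have xV : C1_Lipschitz V (xi i) by apply: C1_Lipschitz_le xiV; rewrite lerDl.
have yV : C1_Lipschitz V (eta i) by apply: C1_Lipschitz_le etaV; rewrite lerDr.
pose L0 := 4 * V * B + 20 * V ^+ 2 * B + 2 * V * K.
have L00 : 0 <= L0 by rewrite !addr_ge0 ?mulr_ge0 ?sqr_ge0.
exists (6 * L0), (2 * V); split; [exact: mulr_ge0|exact: mulr_ge0|].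
move=> A d m rhom e d0 dA m0 rhoe.
have [x01 w0 w1 _] := lobatto_rule _ _ _ nodes m0.
have L := kernel_density_sqrt_Lipschitz _ _ _ _ V0 xV yV _ _ d0 dA _ _ _ K0 B0 rhoK rhoB.
have c0 : 0 <= 1 / d ^+ 2 + 1 / d by rewrite addr_ge0 ?divr_ge0 ?sqr_ge0// ltW.
have E := lobatto_error _ _ _ _ nodes m0 (mulr_ge0 L00 c0) L.
pose f g (t : R) := H xi eta i A t * g t.
rewrite -/(f rho) -/(f rhom).
have -> : integral01 (f rho) - lobatto x m (f rhom) =
  (integral01 (f rho) - lobatto x m (f rho)) +
  (lobatto x m (f rho) - lobatto x m (f rhom)) by ring.
apply: le_trans (ler_normD _ _) _; apply: lerD.
  by apply: le_trans E _; rewrite le_eqVlt; apply/orP; left; apply/eqP; ring.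
rewrite /lobatto -sumrB; apply: le_trans (ler_norm_sum _ _ _) _.
rewrite -[leRHS]mul1r -[X in _ <= X * _]w1 mulr_suml !big_nat; apply: ler_sum => h /= hm.
rewrite -mulrBr normrM (ger0_norm (w0 _ hm)) ler_wpM2l ?w0//.
rewrite /f -mulrBr normrM ler_pM//.
  exact: (kernel_le _ _ _ _ V0 xV yV _ _ d0 dA _ (x01 _ hm)).
by apply: rhoe; exact: x01.
Qed.

Lemma dist_boundary_le (R : realType) (xi eta : 'I_3 -> R -> R) (A : R * R)
    (i : 'I_3) (t : R) : I01 t ->
  dist_boundary xi eta A <= dist2 A (xi i t, eta i t).
Proof.
move=> t01; have arc_le : dist_arc xi eta A i <= dist2 A (xi i t, eta i t).
  by apply: ge_inf; [exists 0 => _ [s _ <-]; exact: sqrtr_ge0|exists t].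
apply: le_trans arc_le; rewrite /dist_boundary !ge_min.
have [->|->|->] : [\/ i = arc1, i = arc2 | i = arc3].
  by case: i => -[|[|[|//]]] i3; [apply: Or31|apply: Or32|apply: Or33]; exact: val_inj.
- by rewrite lexx.
- by rewrite lexx orbT.
- by rewrite lexx !orbT.
Qed.

(** [D] is open, so it contains a ball around [A], which the boundary cannot meet. *)
Lemma dist_boundary_gt0 (R : realType) (D : set (R * R)) (xi eta : 'I_3 -> R -> R)
    (A : R * R) : open D -> boundary D = Sigma xi eta -> D A ->
  0 < dist_boundary xi eta A.
Proof.
move=> oD bD DA; have /nbhs_ballP[e /= e0 eD] := open_nbhs_nbhs (conj oD DA).
have far i t : I01 t -> e <= dist2 A (xi i t, eta i t).
  move=> t01; rewrite leNgt; apply/negP => dist_lt.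
  have : boundary D (xi i t, eta i t) by rewrite bD; exists i, t.
  move=> [_]; apply; rewrite (interior_id D).1//; apply: eD.
  have [h1 h2] := dist2_ge A (xi i t, eta i t).
  by split; rewrite /ball/=; exact: le_lt_trans dist_lt.
have arc_ge i : e <= dist_arc xi eta A i.
  apply: lb_le_inf; last by move=> _ [t t01 <-]; exact: far.
  exists (dist2 A (xi i 0, eta i 0)); exists 0 => //.
  by rewrite /I01/= in_itv/= lexx ler01.
by apply: (lt_le_trans e0); rewrite /dist_boundary !le_min !arc_ge.
Qed.

Lemma norm3_ge (R : realType) (f : 'I_3 -> R -> R) (i : 'I_3) (t : R) :
  {within I01, continuous (f i)} -> I01 t -> `|f i t| <= norm3 f.
Proof.
move=> cf t01; have [B _ fB] := within_continuous_bounded _ cf.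
apply: (@le_trans _ _ (supnorm (f i))).
  by apply: ub_le_sup; [exists B => _ [s s01 <-]; exact: fB|exists t].
exact: (le_bigmax _ (fun j => supnorm (f j))).
Qed.

Theorem theorem3p6 (R : realType)
    (D : set (R * R)) (P0 : R * R) (chi delta : R) (xi eta : 'I_3 -> R -> R)
    (x : nat -> nat -> R) (c eps : R) (m0 : nat)
    (g : R * R -> R) (psi : 'I_3 -> R -> R) (psim : nat -> 'I_3 -> R -> R) :
  corner_domain D P0 chi delta xi eta ->
  Skernels_continuous chi xi eta ->
  lobatto_nodes x ->
  0 < c -> 0 < eps ->
  trivial_kernel (exact_op chi xi eta) ->
  (0 < m0)%N ->
  (forall m, (m0 <= m)%N -> threshold c eps m <= 1) ->
  (exists B : R, forall m, (m0 <= m)%N ->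
     invertible_onX (discrete_op chi xi eta x c eps m) B) ->
  {within Sigma xi eta, continuous g} ->
  inX psi ->
  eq01 (exact_op chi xi eta psi) (fun i t => g (xi i t, eta i t)) ->
  corner_regular chi psi ->
  (forall m, (m0 <= m)%N ->
     inX (psim m) /\
     eq01 (discrete_op chi xi eta x c eps m (psim m)) (fun i t => g (xi i t, eta i t))) ->
  exists C C' : R, 0 < C /\ 0 < C' /\
    forall (A : R * R) (m : nat), D A -> (m0 <= m)%N ->
      let d := dist_boundary xi eta A in
      `|double_layer xi eta psi A - discrete_double_layer xi eta x m (psim m) A| <=
        C / m%:R * (1 / d ^+ 2 + 1 / d) +
        C' / d * norm3 (fun i t => psi i t - psim m i t).
Proof.
move=> dom _ nodes _ _ _ m00 _ _ _ psiX _ psireg psimX.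
have arcs i : exists CC : R * R, [/\ 0 <= CC.1, 0 <= CC.2 &
    forall (A : R * R) (d : R) (m : nat) (rhom : R -> R) (e : R),
      0 < d -> (forall t, I01 t -> d <= dist2 A (xi i t, eta i t)) -> (0 < m)%N ->
      (forall t, I01 t -> `|psi i t - rhom t| <= e) ->
      `|integral01 (fun t => H xi eta i A t * psi i t) -
        lobatto x m (fun t => H xi eta i A t * rhom t)| <=
      CC.1 / m%:R * (1 / d ^+ 2 + 1 / d) + CC.2 / d * e].
  have [xiC2 etaC2] := cd_C2 dom i.
  have [chi1 _] := cd_chi dom.
  have [K K0 psiK] := density_sqrt_Lipschitz _ _ i chi1 psiX psireg.
  have [C [C' [C0 C'0 CC]]] := arc_potential_error _ _ _ _ _ _ _ xiC2 etaC2 nodes K0 psiK.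
  by exists (C, C').
have [CC CCP] := choice arcs.
exists (\sum_(i < 3) (CC i).1 + 1), (\sum_(i < 3) (CC i).2 + 1).
have S0 (F : 'I_3 -> R) : (forall i, 0 <= F i) -> 0 < \sum_(i < 3) F i + 1.
  by move=> F0; rewrite ltr_wpDl// sumr_ge0.
split; first by apply: S0 => i; have [] := CCP i.
split; first by apply: S0 => i; have [] := CCP i.
move=> A m DA mm0; cbv zeta; set d := dist_boundary xi eta A.
have [_ oD _ _] := cd_region dom.
have d0 : 0 < d by exact: dist_boundary_gt0 oD (cd_boundary dom) DA.
have m_gt0 : (0 < m)%N by exact: leq_trans mm0.
set e := norm3 _.
have psi_e i t : I01 t -> `|psi i t - psim m i t| <= e.
  move=> t01; apply: (norm3_ge _ (fun i t => psi i t - psim m i t)) => //.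
  by move=> s; apply: cvgB; [exact: psiX.1|exact: (psimX m mm0).1.1].
have e0 : 0 <= e.
  by apply: le_trans (psi_e arc1 0 _) => //; rewrite /I01/= in_itv/= lexx ler01.
rewrite /double_layer /discrete_double_layer -sumrB.
apply: le_trans (ler_norm_sum _ _ _) _.
apply: (@le_trans _ _ (\sum_(i < 3)
  ((CC i).1 / m%:R * (1 / d ^+ 2 + 1 / d) + (CC i).2 / d * e))).
  apply: ler_sum => i _; have [_ _ H] := CCP i.
  apply: H => //; last exact: psi_e.
  by move=> t t01; exact: dist_boundary_le.
have di : 0 <= d^-1 by rewrite invr_ge0 ltW.
rewrite big_split/= -!mulr_suml lerD// !ler_wpM2r// ?lerDl ?invr_ge0//.
by rewrite addr_ge0 ?divr_ge0 ?sqr_ge0// ltW.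
Qed.
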